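(* Consider the stochastic linear bandit model and the LinIMED-2 algorithm described in the context. Suppose Assumption 1 holds and $\sqrt{\lambda}S\ge 1$. Then the expected cumulative regret of LinIMED-2 satisfies $$R_T \le O\big(d\sqrt{T}\log^{3/2}(T)\big),$$ where the constant in $O(\cdot)$ does not depend on $T$ or $d$.
   Context: Stochastic linear bandit model: at each round $t=1,\dots,T$ the learner observes an arm set $\mathcal{A}_t$ (possibly infinite), each arm $a\in\mathcal{A}_t$ having a known context vector $x_{t,a}\in\mathbb{R}^d$. The learner chooses $A_t\in\mathcal{A}_t$, writes $X_t:=x_{t,A_t}$, and observes $Y_t=\langle\theta^*,X_t\rangle+\eta_t$, where $\theta^*\in\mathbb{R}^d$ is unknown and $\eta_t$ is $R$-sub-Gaussian conditionally on $A_1,\dots,A_t,Y_1,\dots,Y_{t-1}$, i.e. $\mathbb{E}[\exp(\lambda'\eta_t)\mid A_1,\dots,A_t,Y_1,\dots,Y_{t-1}]\le\exp(\lambda'^2R^2/2)$ a.s. for all $\lambda'\in\mathbb{R}$. The expected cumulative regret is $R_T=\mathbb{E}\big[\sum_{t=1}^T \max_{a\in\mathcal{A}_t}\langle\theta^*,x_{t,a}\rangle-\langle\theta^*,X_t\rangle\big]$. Assumption 1: $\|x_{t,a}\|\le L$ for all $t,a$ (in particular $\|X_t\|\le L$), $\|\theta^*\|\le S$, and $\max_{a\in\mathcal{A}_t}\langle\theta^*,x_{t,a}\rangle-\langle\theta^*,x_{t,b}\rangle\le 1$ for all $t$ and $b\in\mathcal{A}_t$. Notation: $\|x\|_A=\sqrt{x^\top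 Ax}$; $a\wedge b=\min(a,b)$. LinIMED-$x$ ($x\in\{1,2,3\}$), with parameters $\lambda>0$, $C\ge1$, horizon $T$: set $V_0=\lambda I_d$, $W_0=0$, $\hat\theta_{t}=V_{t}^{-1}W_{t}$. At round $t$, with $\gamma=1/t^2$, set $\beta_{t-1}=\big(R\sqrt{d\log\frac{1+(t-1)L^2/\lambda}{\gamma}}+\sqrt\lambda S\big)^2$. For each $a\in\mathcal{A}_t$ let $\hat\mu_{t,a}=\langle\hat\theta_{t-1},x_{t,a}\rangle$ and $\mathrm{UCB}_t(a)=\hat\mu_{t,a}+\sqrt{\beta_{t-1}}\|x_{t,a}\|_{V_{t-1}^{-1}}$. For $x\in\{1,2\}$, $\hat\Delta_{t,a}=\max_{j}\hat\mu_{t,j}-\hat\mu_{t,a}$ and the ''leader'' is $\arg\max_j\hat\mu_{t,j}$; for $x=3$, $\hat\Delta_{t,a}=\max_j\mathrm{UCB}_t(j)-\mathrm{UCB}_t(a)$ and the leader is $\arg\max_j\mathrm{UCB}_t(j)$. Writing $g_{t,a}=\beta_{t-1}\|x_{t,a}\|^2_{V_{t-1}^{-1}}$, the index of the leader $a$ is $I_{t,a}=-\log g_{t,a}$ (LinIMED-1), $I_{t,a}=\log T\wedge(-\log g_{t,a})$ (LinIMED-2), $I_{t,a}=\log\frac{C}{\max_{b\in\mathcal{A}_t}\hat\Delta_{t,b}^2}\wedge(-\log g_{t,a})$ (LinIMED-3); for every other arm $I_{t,a}=\hat\Delta_{t,a}^2/g_{t,a}-\log g_{t,a}$. The algorithm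 pulls $A_t=\arg\min_a I_{t,a}$ (ties arbitrary), observes $Y_t$, and updates $V_t=V_{t-1}+X_tX_t^\top$, $W_t=W_{t-1}+Y_tX_t$. *)

(* Defs.v *)
From HB Require Import structures.
From mathcomp Require Import all_boot all_order all_algebra.
From mathcomp Require Import all_classical all_reals all_analysis.
Set Implicit Arguments. Unset Strict Implicit. Unset Printing Implicit Defensive.
Import Order.TTheory GRing.Theory Num.Theory.
Local Open Scope classical_set_scope.
Local Open Scope ring_scope.

Section LinIMED.
Variables (R : realType) (d : nat).

Definition dotv (u v : 'cV[R]_d) : R := (u^T *m v) 0 0.
Definition enorm (x : 'cV[R]_d) : R := Num.sqrt (dotv x x).
Definition qform (A : 'M[R]_d) (x : 'cV[R]_d) : R := (x^T *m A *m x) 0 0.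

Definition Vmat (lam : R) (X : nat -> 'cV[R]_d) (t : nat) : 'M[R]_d :=
  lam%:M + \sum_(1 <= s < t.+1) (X s *m (X s)^T).

Definition Yobs (th : 'cV[R]_d) (X : nat -> 'cV[R]_d) (eta : nat -> R) (s : nat) : R :=
  dotv th (X s) + eta s.

Definition Wvec (th : 'cV[R]_d) (X : nat -> 'cV[R]_d) (eta : nat -> R) (t : nat)
  : 'cV[R]_d := \sum_(1 <= s < t.+1) (Yobs th X eta s *: X s).

Definition thetahat (lam : R) (th : 'cV[R]_d) (X : nat -> 'cV[R]_d) (eta : nat -> R)
  (t : nat) : 'cV[R]_d := invmx (Vmat lam X t) *m Wvec th X eta t.

(* beta_{t-1} at round t, with gamma = 1/t^2 *)
Definition beta_round (Rsg L lam S : R) (t : nat) : R :=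
  let gamma := 1 / (t%:R ^+ 2) in
  (Rsg * Num.sqrt (d%:R * ln ((1 + (t - 1)%:R * L ^+ 2 / lam) / gamma))
   + Num.sqrt lam * S) ^+ 2.

(* LinIMED-2 index of arm (context) a at a round, given beta = beta_{t-1},
   Vinv = V_{t-1}^{-1}, thh = hat theta_{t-1} and the chosen leader [lead]
   (an arm maximizing the empirical mean).  g = beta ||a||^2_{V^{-1}}.
   -log g is read as +oo when g = 0 (extended reals). *)
Definition linimed2_index (T : nat) (beta : R) (Vinv : 'M[R]_d)
  (thh : 'cV[R]_d) (lead a : 'cV[R]_d) : \bar R :=
  let g := beta * qform Vinv a in
  let Dh := dotv thh lead - dotv thh a in
  if a == lead then
    (if g == 0 then (ln T%:R)%:E else (Num.min (ln T%:R) (- ln g))%:E)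
  else
    (if g == 0 then +oo%E else (Dh ^+ 2 / g - ln g)%:E).

Definition linimed2_round (Rsg L lam S : R) (T : nat) (Arms : nat -> set 'cV[R]_d)
  (th : 'cV[R]_d) (X : nat -> 'cV[R]_d) (eta : nat -> R) (t : nat) : Prop :=
  let beta := beta_round Rsg L lam S t in
  let Vinv := invmx (Vmat lam X t.-1) in
  let thh := thetahat lam th X eta t.-1 in
  exists lead, Arms t lead /\
    (forall a, Arms t a -> dotv thh a <= dotv thh lead) /\
    Arms t (X t) /\
    (forall a, Arms t a ->
       (linimed2_index T beta Vinv thh lead (X t) <= linimed2_index T beta Vinv thh lead a)%E).

Definition history_sigma {dO} {O : measurableType dO} (th : 'cV[R]_d)
  (X : nat -> O -> 'cV[R]_d) (eta : nat -> O -> R) (t : nat) : set (set O) :=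
  <<s ([set B | exists s i (C : set R), (1 <= s <= t)%N /\ measurable C /\
                 B = [set w | C (X s w i 0)]]
       `|` [set B | exists s (C : set R), (1 <= s < t)%N /\ measurable C /\
                 B = [set w | C (Yobs th (X ^~ w) (eta ^~ w) s)]]) >>.

(* eta_t is Rsg-sub-Gaussian conditionally on the history sigma-algebra F:
   E[exp(l eta_t) | F] <= exp(l^2 Rsg^2/2) a.s., written via the defining
   property of conditional expectation: for every B in F,
   E[exp(l eta_t) 1_B] <= exp(l^2 Rsg^2/2) P(B). *)
Definition cond_subgaussian {dO} {O : measurableType dO} (P : probability O R)
  (F : set (set O)) (Rsg : R) (e : O -> R) : Prop :=
  forall (l : R) (B : set O), F B ->
    (\int[P]_(w in B) (expR (l * e w))%:E
       <= (expR (l ^+ 2 * Rsg ^+ 2 / 2))%:E * P B)%E.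

Definition inst_regret (Arms : nat -> set 'cV[R]_d) (th : 'cV[R]_d)
  (X : nat -> 'cV[R]_d) (t : nat) : R :=
  sup [set dotv th a | a in Arms t] - dotv th (X t).

Definition exp_regret {dO} {O : measurableType dO} (P : probability O R)
  (Arms : nat -> set 'cV[R]_d) (th : 'cV[R]_d) (X : nat -> O -> 'cV[R]_d)
  (T : nat) : \bar R :=
  \int[P]_w (\sum_(1 <= t < T.+1) inst_regret Arms th (X ^~ w) t)%:E.

End LinIMED.

(* Main.v *)
Require Import Defs.
From HB Require Import structures.
From mathcomp Require Import all_boot all_order all_algebra finmap.
From mathcomp Require Import all_classical all_reals all_analysis.
From mathcomp Require Import measurable_realfun ring lra.
Import Order.TTheory GRing.Theory Num.Theory.
Local Open Scope classical_set_scope.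
Local Open Scope ring_scope.
Set Implicit Arguments. Unset Strict Implicit. Unset Printing Implicit Defensive.

(* Confidence. With S_t = sum_{s <= t} eta_s X_s and q = ||X_{t+1}||^2 in the norm of V_t^-1, the
   process (det V_t / lambda^d)^(-1/2) exp(||S_t||^2_{V_t^-1} / (2 sigma^2)), sigma >= R, is a
   supermartingale. By Sherman-Morrison its one-step factor is the integral of
   exp(l eta - l^2 sigma^2 / 2) over l against a normal density whose mean and variance q / sigma^2
   are known before eta is observed, so Tonelli reduces the claim to the sub-Gaussian bound at each
   fixed l. Since det V_t <= (lambda + t L^2)^d (Hadamard), Markov's inequality gives
   |<theta_hat_{t-1} - theta, a>| <= 2 sqrt(g_a) for all arms a at round t, outside an event of
   probability at most 1/t.

   Regret. Let I be the index of the pulled arm A. Comparison with the leader gives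
   exp(-I) <= 1/T + g_A and, when g_A <= 1, an estimated gap of A at most sqrt(g_A log T). An arm b
   whose optimistic value 2 sqrt(g_b) exceeds its estimated gap has index at most 4 - log g_b,
   hence g_b <= e^4 (1/T + g_A). So the regret of the round is
   O(1/sqrt T + sqrt(log T) sqrt(min(1, g_A))), and these bounds are summed with Cauchy-Schwarz and
   the elliptical potential sum_t min(1, q_t) <= 2 d log(1 + T L^2 / lambda). *)

(** * Positive definite matrices *)

Section PositiveDefinite.
Variable R : realType.

Definition bform {n} (A : 'M[R]_n) (x y : 'cV[R]_n) : R := (x^T *m A *m y) 0 0.

(** Symmetry is part of the notion: over the reals positivity of the form does not imply it. *)
Definition posmx {n} (A : 'M[R]_n) : Prop :=
  A^T = A /\ forall x, x != 0 -> 0 < qform A x.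

Lemma qformE n (A : 'M[R]_n) x : qform A x = bform A x x.
Proof. by []. Qed.

Lemma dotvE n (x y : 'cV[R]_n) : dotv x y = bform 1%:M x y.
Proof. by rewrite /dotv /bform mulmx1. Qed.

Lemma bformDl n (A : 'M[R]_n) x y z : bform A (x + y) z = bform A x z + bform A y z.
Proof. by rewrite /bform linearD /= !mulmxDl mxE. Qed.

Lemma bformDr n (A : 'M[R]_n) x y z : bform A z (x + y) = bform A z x + bform A z y.
Proof. by rewrite /bform mulmxDr mxE. Qed.

Lemma bformZl n (A : 'M[R]_n) c x z : bform A (c *: x) z = c * bform A x z.
Proof. by rewrite /bform linearZ /= -!scalemxAl mxE. Qed.

Lemma bformZr n (A : 'M[R]_n) c x z : bform A z (c *: x) = c * bform A z x.
Proof. by rewrite /bform -scalemxAr mxE. Qed.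

Lemma bformNl n (A : 'M[R]_n) x z : bform A (- x) z = - bform A x z.
Proof. by rewrite -scaleN1r bformZl mulN1r. Qed.

Lemma bformNr n (A : 'M[R]_n) x z : bform A z (- x) = - bform A z x.
Proof. by rewrite -scaleN1r bformZr mulN1r. Qed.

Lemma bformDm n (A B : 'M[R]_n) x y : bform (A + B) x y = bform A x y + bform B x y.
Proof. by rewrite /bform mulmxDr mulmxDl mxE. Qed.

Lemma bformZm n (A : 'M[R]_n) c x y : bform (c *: A) x y = c * bform A x y.
Proof. by rewrite /bform -scalemxAr -scalemxAl mxE. Qed.

Lemma bform0r n (A : 'M[R]_n) x : bform A x 0 = 0.
Proof. by rewrite /bform mulmx0 mxE. Qed.

Lemma bform0l n (A : 'M[R]_n) x : bform A 0 x = 0.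
Proof. by rewrite /bform trmx0 !mul0mx mxE. Qed.

Lemma bformC n (A : 'M[R]_n) x y : A^T = A -> bform A x y = bform A y x.
Proof.
by move=> sA; rewrite /bform -[RHS]trace_mx11 -mxtrace_tr trace_mx11 !trmx_mul trmxK sA mulmxA.
Qed.

Lemma bform_rank1 n (z x y : 'cV[R]_n) :
  bform (z *m z^T) x y = dotv z x * dotv z y.
Proof.
rewrite /bform /dotv !mulmxA -mulmxA [_ *m z]mx11_scalar mul_scalar_mx mxE; congr (_ * _).
by rewrite -[LHS]trace_mx11 -mxtrace_tr trace_mx11 trmx_mul trmxK.
Qed.

Lemma dotv_sum n (x y : 'cV[R]_n) : dotv x y = \sum_i x i 0 * y i 0.
Proof. by rewrite /dotv mxE; apply: eq_bigr => i _; rewrite mxE. Qed.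

Lemma dotvv_ge0 n (x : 'cV[R]_n) : 0 <= dotv x x.
Proof. by rewrite dotv_sum sumr_ge0 // => i _; rewrite -expr2 sqr_ge0. Qed.

Lemma dotvv_gt0 n (x : 'cV[R]_n) : x != 0 -> 0 < dotv x x.
Proof.
move=> x0; rewrite lt_neqAle dotvv_ge0 andbT eq_sym; apply: contra_neq x0.
rewrite dotv_sum => /eqP; rewrite psumr_eq0; last by move=> i _; rewrite -expr2 sqr_ge0.
move=> /allP h; apply/matrixP => i j; rewrite ord1 mxE.
by have := h i (mem_index_enum _); rewrite mulf_eq0 orbb => /eqP.
Qed.

Lemma posmx1 n : @posmx n 1%:M.
Proof. by split; [rewrite trmx1|move=> x /dotvv_gt0; rewrite dotvE]. Qed.

Section posmx_theory.
Context {n : nat} (A : 'M[R]_n).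
Hypothesis pA : posmx A.

Lemma qform_ge0 x : 0 <= qform A x.
Proof.
by have [->|/(proj2 pA)/ltW //] := eqVneq x 0; rewrite qformE bform0r.
Qed.

Lemma qform_eq0 x : (qform A x == 0) = (x == 0).
Proof.
apply/eqP/eqP => [q0|->]; last by rewrite qformE bform0r.
by apply/eqP; apply/negPn/negP => /(proj2 pA); rewrite q0 ltxx.
Qed.

Lemma posmx_unit : A \in unitmx.
Proof.
rewrite unitmxE unitfE; apply/det0P => -[v v0 vA].
have : v^T != 0 by apply: contra_neq v0 => /(congr1 trmx); rewrite trmxK trmx0.
by move=> /(proj2 pA); rewrite /qform trmxK vA mul0mx mxE ltxx.
Qed.

Lemma posmx_inv : posmx (invmx A).
Proof.
have sV : (invmx A)^T = invmx A by rewrite trmx_inv (proj1 pA).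
split=> // x x0.
have -> : qform (invmx A) x = qform A (invmx A *m x).
  by rewrite /qform trmx_mul sV -!mulmxA mulKVmx // posmx_unit.
apply: (proj2 pA); apply: contra_neq x0 => /(congr1 (mulmx A)).
by rewrite mulmx0 mulKVmx // posmx_unit.
Qed.

Lemma bform_CS x y : bform A x y ^+ 2 <= qform A x * qform A y.
Proof.
have [->|y0] := eqVneq y 0.
  by rewrite bform0r expr0n (qformE A 0) bform0r mulr0.
(* The component of [x] orthogonal to [y], scaled by [qform A y] to avoid a division. *)
have := qform_ge0 (qform A y *: x - bform A x y *: y).
have qy := proj2 pA _ y0.
rewrite qformE !(bformDl, bformDr, bformZl, bformZr, bformNl, bformNr).
rewrite (bformC y x (proj1 pA)) -!qformE.
rewrite [X in 0 <= X](_ : _ = qform A y * (qform A x * qform A y - bform A x y ^+ 2)).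
  by rewrite pmulr_rge0 // subr_ge0.
by ring.
Qed.

Lemma bform_CS_sqrt x y : `|bform A x y| <= Num.sqrt (qform A x) * Num.sqrt (qform A y).
Proof.
by rewrite -sqrtrM ?qform_ge0 // -sqrtr_sqr ler_sqrt ?bform_CS // mulr_ge0 ?qform_ge0.
Qed.

Lemma posmx_rank1 (x : 'cV[R]_n) : posmx (A + x *m x^T).
Proof.
split; first by rewrite linearD /= trmx_mul trmxK (proj1 pA).
move=> y y0; rewrite qformE bformDm bform_rank1.
by rewrite ltr_pwDl // ?(proj2 pA) // -expr2 sqr_ge0.
Qed.

End posmx_theory.

(** Matrix determinant lemma: the bordered matrix with rows [(1, - x^T)] and [(x, A)] is factored in
    two ways, clearing either off-diagonal block, and the determinants are compared. *)
Lemma det_rank1 n (A : 'M[R]_n) (x : 'cV[R]_n) : A \in unitmx ->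
  \det (A + x *m x^T) = \det A * (1 + qform (invmx A) x).
Proof.
move=> uA.
have e1 : block_mx (1%:M : 'M[R]_1) (- x^T) x A =
   block_mx 1%:M 0 x 1%:M *m block_mx 1%:M (- x^T) 0 (A + x *m x^T).
  rewrite mulmx_block !mul1mx !mul0mx !addr0 mulmxN; congr block_mx.
    by rewrite mulmx1.
  by rewrite addrC addrK.
have e2 : block_mx (1%:M : 'M[R]_1) (- x^T) x A =
   block_mx 1%:M (- x^T *m invmx A) 0 1%:M *m block_mx (1%:M + x^T *m invmx A *m x) 0 x A.
  rewrite mulmx_block !mul1mx !mul0mx !add0r -!mulmxA mulVmx // mulmx1 ?mulmxA.
  by rewrite !mulNmx addrK.
have := congr1 determinant e1; rewrite {1}e2 !det_mulmx !(det_ublock, det_lblock) !det1 !mul1r.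
by move=> <-; rewrite det_mx11 mxE [1%:M _ _]mxE eqxx mulr1n mulrC.
Qed.

(** Sherman-Morrison formula; a right inverse suffices, the updated matrix being already
    invertible. *)
Lemma invmx_rank1 n (A : 'M[R]_n) (x : 'cV[R]_n) : posmx A ->
  invmx (A + x *m x^T) =
  invmx A - (1 + qform (invmx A) x)^-1 *: (invmx A *m x *m (x^T *m invmx A)).
Proof.
move=> pA; have uA := posmx_unit pA; have uB := posmx_unit (posmx_rank1 pA x).
set q := qform _ _.
have q0 : 1 + q != 0 by rewrite gt_eqF // ltr_pwDl // qform_ge0 //; exact: posmx_inv.
set B := _ - _.
suff e : (A + x *m x^T) *m B = 1%:M by rewrite -[LHS]mulmx1 -e mulKmx.
rewrite /B mulmxBr mulmxDl mulmxV // -scalemxAr mulmxDl.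
have -> : A *m (invmx A *m x *m (x^T *m invmx A)) = x *m x^T *m invmx A.
  by rewrite !mulmxA mulmxV // mul1mx.
have -> : x *m x^T *m (invmx A *m x *m (x^T *m invmx A)) = q *: (x *m x^T *m invmx A).
  rewrite -!mulmxA (mulmxA x^T) (mulmxA _ x) [_ *m x]mx11_scalar.
  by rewrite mul_scalar_mx -scalemxAr.
set Z := x *m x^T *m _.
have -> : Z + q *: Z = (1 + q) *: Z by rewrite scalerDl scale1r.
by rewrite scalerA mulVf // scale1r addrK.
Qed.

Lemma block_qform n (a : R) (b : 'cV[R]_n) (D : 'M[R]_n) c y :
  qform (block_mx a%:M b^T b D) (col_mx c%:M y) =
  a * c ^+ 2 + c * dotv b y *+ 2 + qform D y.
Proof.
rewrite /qform tr_col_mx mul_row_block mul_row_col tr_scalar_mx.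
have yb : (y^T *m b) 0 0 = dotv b y.
  by rewrite -[LHS]trace_mx11 -mxtrace_tr trace_mx11 trmx_mul trmxK.
rewrite !mulmxDl !mul_mx_scalar !mul_scalar_mx -scalemxAl scale_scalar_mx.
have dE (M N : 'M[R]_1) : (M + N) 0 0 = M 0 0 + N 0 0 by rewrite mxE.
have zE k (M : 'M[R]_1) : (k *: M) 0 0 = k * M 0 0 by rewrite mxE.
rewrite !(dE, zE) yb -/(dotv b y) -/(qform D y) [_%:M _ _]mxE eqxx mulr1n.
by ring.
Qed.

(** Hadamard's inequality, by induction on the size: the Schur complement [C] of the corner [a] is
    positive definite, [\det A = a * \det C], and the diagonal of [C] lies below that of [D]. *)
Lemma posmx_det n (A : 'M[R]_n) : posmx A -> 0 < \det A /\ \det A <= \prod_i A i i.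
Proof.
elim: n A => [|n IH] A pA; first by rewrite det_mx00 big_ord0.
have [a [b [D AE]]] : exists (a : R) (b : 'cV[R]_n) (D : 'M[R]_n), A = block_mx a%:M b^T b D :> 'M[R]_(1 + n).
  exists (A 0 0), (@dlsubmx _ 1 n 1 n A), (@drsubmx _ 1 n 1 n A).
  rewrite -[LHS](@submxK _ 1 n 1 n); congr block_mx.
    by rewrite [LHS]mx11_scalar; congr (_%:M); rewrite !mxE; congr (A _ _); apply/val_inj.
  by rewrite (@trmx_dlsub _ 1 n 1 n) (proj1 pA).
have symD : D^T = D.
  have := proj1 pA; rewrite AE (@tr_block_mx _ 1 n 1 n) => /(@eq_block_mx _ 1 n 1 n) [_ _ _ //].
have a0 : 0 < a.
  have : (col_mx 1%:M 0 : 'cV[R]_(1 + n)) != 0.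
    apply/eqP => /(congr1 (fun M : 'cV[R]_(1 + n) => M (lshift n 0) 0)).
    by rewrite (@col_mxEu _ 1 n 1) !mxE eqxx => /eqP; rewrite oner_eq0.
  move/(proj2 pA); rewrite AE block_qform expr1n mulr1 dotvE bform0r qformE bform0r.
  by rewrite mulr0 mul0rn !addr0.
pose C := D - a^-1 *: (b *m b^T).
have pC : posmx C.
  split; first by rewrite /C linearB linearZ /= trmx_mul trmxK symD.
  move=> y y0.
  (* This first coordinate minimizes the form of [A] over vectors with lower part [y]; the minimum
     is [qform C y]. *)
  have : (col_mx (- (a^-1 * dotv b y))%:M y : 'cV[R]_(1 + n)) != 0.
    apply: contra_neq y0 => /(congr1 (@dsubmx _ 1 n 1)); rewrite col_mxKd => ->.
    by apply/matrixP => i j; rewrite !mxE.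
  move/(proj2 pA); rewrite AE block_qform.
  have -> : qform C y = qform D y - a^-1 * dotv b y ^+ 2.
    by rewrite qformE /C bformDm -scaleNr bformZm bform_rank1 mulNr expr2.
  congr (0 < _); field; exact: lt0r_neq0.
have detA : \det A = a * \det C.
  have -> : A = block_mx (1%:M : 'M[R]_1) 0 (a^-1 *: b) 1%:M *m block_mx a%:M b^T 0 C :> 'M[R]_(1 + n).
    rewrite mulmx_block !mul1mx !mul0mx !addr0 AE; congr block_mx.
      by rewrite mul_mx_scalar scalerA divff ?scale1r // gt_eqF.
    by rewrite /C -scalemxAl addrC subrK.
  by rewrite det_mulmx (@det_lblock _ 1 n) (@det_ublock _ 1 n) !det1 !mul1r det_mx11 mxE eqxx mulr1n.
have [C0 Cle] := IH C pC.
rewrite detA; split; first exact: mulr_gt0.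
have -> : \prod_i A i i = a * \prod_i D i i.
  rewrite big_ord_recl; congr (_ * _).
    rewrite AE; have -> : ord0 = lshift n ord0 :> 'I_(1 + n) by apply/val_inj.
    by rewrite (@block_mxEul _ 1 n 1 n) mxE eqxx.
  apply: eq_bigr => i _; rewrite AE.
  have -> : lift ord0 i = rshift 1 i :> 'I_(1 + n) by apply/val_inj.
  by rewrite (@block_mxEdr _ 1 n 1 n).
rewrite ler_pM2l // (le_trans Cle) //; apply: ler_prod => i _.
have diagE (M : 'M[R]_n) : M i i = qform M (delta_mx i 0).
  by rewrite /qform trmx_delta -rowE -colE !mxE.
rewrite [X in 0 <= X]diagE qform_ge0 //= !mxE lerBlDr lerDl.
rewrite mulr_ge0 ?invr_ge0 ?(ltW a0) //.
by rewrite big_ord1 !mxE -expr2 sqr_ge0.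
Qed.

End PositiveDefinite.

(** * Ridge regression *)

Section RidgeRegression.
Context {R : realType} {d : nat}.
Implicit Types (lam : R) (X : nat -> 'cV[R]_d) (th : 'cV[R]_d).

Definition noise_sum X (eta : nat -> R) (t : nat) : 'cV[R]_d :=
  \sum_(1 <= s < t.+1) (eta s *: X s).

Lemma noise_sumS X eta t : noise_sum X eta t.+1 = noise_sum X eta t + eta t.+1 *: X t.+1.
Proof. by rewrite /noise_sum big_nat_recr. Qed.

Lemma Vmat0 lam X : Vmat lam X 0 = lam%:M.
Proof. by rewrite /Vmat big_geq ?addr0. Qed.

Lemma VmatS lam X t : Vmat lam X t.+1 = Vmat lam X t + X t.+1 *m (X t.+1)^T.
Proof. by rewrite /Vmat big_nat_recr //= addrA. Qed.

Lemma posmx_scalar (n : nat) lam : 0 < lam -> posmx (lam%:M : 'M[R]_n).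
Proof.
move=> lam0; split; first by rewrite tr_scalar_mx.
by move=> x x0; rewrite qformE -scalemx1 bformZm mulr_gt0 // -dotvE dotvv_gt0.
Qed.

Lemma posmx_Vmat lam X t : 0 < lam -> posmx (Vmat lam X t).
Proof.
move=> lam0; elim: t => [|t IH]; first by rewrite Vmat0; exact: posmx_scalar.
by rewrite VmatS; exact: posmx_rank1.
Qed.

(** Indexed by the number of past rounds: it belongs to round [t.+1]. *)
Definition weight lam X t : R := qform (invmx (Vmat lam X t)) (X t.+1).

Lemma weight_ge0 lam X t : 0 < lam -> 0 <= weight lam X t.
Proof. by move=> lam0; apply: qform_ge0; exact/posmx_inv/posmx_Vmat. Qed.

Lemma det_VmatS lam X t : 0 < lam ->
  \det (Vmat lam X t.+1) = \det (Vmat lam X t) * (1 + weight lam X t).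
Proof. by move=> lam0; rewrite VmatS det_rank1 // posmx_unit //; exact: posmx_Vmat. Qed.

Lemma det_Vmat_gt0 lam X t : 0 < lam -> 0 < \det (Vmat lam X t).
Proof. by move=> lam0; have [] := posmx_det (posmx_Vmat X t lam0). Qed.

Lemma sqr_entry_le_dotv (x : 'cV[R]_d) i : x i 0 ^+ 2 <= dotv x x.
Proof.
rewrite dotv_sum (bigD1 i) //= -expr2 lerDl sumr_ge0 // => j _.
by rewrite -expr2 sqr_ge0.
Qed.

Lemma enorm_ge0 (x : 'cV[R]_d) : 0 <= enorm x.
Proof. exact: sqrtr_ge0. Qed.

Lemma sqr_enorm (x : 'cV[R]_d) : enorm x ^+ 2 = dotv x x.
Proof. by rewrite sqr_sqrtr // dotvv_ge0. Qed.

Lemma det_Vmat_le lam L X t : 0 < lam ->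
  (forall s, (1 <= s <= t)%N -> enorm (X s) <= L) ->
  \det (Vmat lam X t) <= (lam + t%:R * L ^+ 2) ^+ d.
Proof.
move=> lam0 XL; have pV := posmx_Vmat X t lam0.
have [_ /le_trans] := posmx_det pV; apply.
rewrite -[X in _ <= _ ^+ X](card_ord d) -prodr_const; apply: ler_prod => i _.
have diagE : Vmat lam X t i i = lam + \sum_(1 <= s < t.+1) X s i 0 ^+ 2.
  rewrite /Vmat !mxE eqxx mulr1n summxE; congr (_ + _); apply: eq_bigr => s _.
  by rewrite !mxE big_ord1 !mxE expr2.
rewrite diagE addr_ge0 ?(ltW lam0) ?sumr_ge0 //=; last by move=> s _; rewrite sqr_ge0.
rewrite lerD2l (@le_trans _ _ (\sum_(1 <= s < t.+1) L ^+ 2)) //; last first.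
  by rewrite sumr_const_nat subn1 /= mulr_natl.
rewrite big_nat [leRHS]big_nat; apply: ler_sum => s; rewrite ltnS => st.
rewrite (le_trans (sqr_entry_le_dotv _ _)) // -sqr_enorm ler_sqr ?nnegrE ?enorm_ge0 //.
  exact: XL.
by rewrite (le_trans (enorm_ge0 (X s))) // XL.
Qed.

Lemma sum_ln_weight lam X t : 0 < lam ->
  \sum_(0 <= s < t) ln (1 + weight lam X s) = ln (\det (Vmat lam X t) / lam ^+ d).
Proof.
move=> lam0; elim: t => [|t IH].
  by rewrite big_geq // Vmat0 det_scalar divff ?ln1 // expf_neq0 // gt_eqF.
have q0 := weight_ge0 X t lam0.
rewrite big_nat_recr //= IH -lnM ?posrE.
- by rewrite det_VmatS // mulrAC.
- by rewrite divr_gt0 ?det_Vmat_gt0 ?exprn_gt0.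
- by rewrite ltr_pwDl.
Qed.

Lemma det_ratio_le lam L X t : 0 < lam ->
  (forall s, (1 <= s <= t)%N -> enorm (X s) <= L) ->
  \det (Vmat lam X t) / lam ^+ d <= (1 + t%:R * L ^+ 2 / lam) ^+ d.
Proof.
move=> lam0 XL; rewrite ler_pdivrMr ?exprn_gt0 // -exprMn mulrDl mul1r divfK ?gt_eqF //.
exact: det_Vmat_le.
Qed.

(** Combines [min 1 q <= 2 * ln (1 + q)] with the telescoping of the log-determinants and Hadamard's
    bound on the last one. *)
Lemma elliptical_potential lam L X t : 0 < lam ->
  (forall s, (1 <= s <= t)%N -> enorm (X s) <= L) ->
  \sum_(0 <= s < t) Num.min 1 (weight lam X s) <= 2 * d%:R * ln (1 + t%:R * L ^+ 2 / lam).
Proof.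
move=> lam0 XL.
have base1 : 1 <= 1 + t%:R * L ^+ 2 / lam.
  by rewrite lerDl divr_ge0 ?(ltW lam0) // mulr_ge0 ?sqr_ge0.
have h : \sum_(0 <= s < t) ln (1 + weight lam X s) <= d%:R * ln (1 + t%:R * L ^+ 2 / lam).
  rewrite sum_ln_weight // mulr_natl -lnXn ?(lt_le_trans ltr01) //.
  rewrite ler_ln ?posrE; first exact: det_ratio_le.
    by rewrite divr_gt0 ?det_Vmat_gt0 ?exprn_gt0.
  by rewrite exprn_gt0 // (lt_le_trans ltr01).
rewrite -mulrA; apply: le_trans (ler_wpM2l (ler0n _ 2) h).
rewrite mulr_sumr; apply: ler_sum => s _; have q0 := weight_ge0 X s lam0.
set q := weight _ _ _ in q0 *.
have lnge (x : R) : 0 < x -> 1 - x^-1 <= ln x.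
  move=> x0; have x'0 : 0 < x^-1 by rewrite invr_gt0.
  have := @le_ln1Dx R (x^-1 - 1); rewrite (_ : 1 + (x^-1 - 1) = x^-1); last by ring.
  by rewrite lnV ?posrE // => h'; have := h' ltac:(lra); lra.
have q1 : 0 < 1 + q by rewrite ltr_pwDl.
have := lnge _ q1; have [c|c] := leP 1 q.
  move=> hl; have : (1 + q)^-1 <= 2^-1 by rewrite lef_pV2 ?posrE //; lra.
  by move=> ?; lra.
have -> : 1 - (1 + q)^-1 = q / (1 + q) by field; rewrite gt_eqF.
move=> hl; have : q / 2 <= q / (1 + q).
  by rewrite ler_wpM2l // lef_pV2 ?posrE //; lra.
by move=> ?; lra.
Qed.

(** The correction depends only on [e], [u] and [q], and is the exponent that the Gaussian integral
    produces below, up to the factor [1 / (2 * sg ^+ 2)]. *)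
Lemma qform_inv_update lam X S (e : R) t : 0 < lam ->
  let q := weight lam X t in
  let u := bform (invmx (Vmat lam X t)) (X t.+1) S in
  qform (invmx (Vmat lam X t.+1)) (S + e *: X t.+1) =
  qform (invmx (Vmat lam X t)) S + (2 * e * u + e ^+ 2 * q - u ^+ 2) / (1 + q).
Proof.
move=> lam0 q u; have pV := posmx_Vmat X t lam0.
have q0 : 0 <= q := weight_ge0 X t lam0.
have sV := proj1 (posmx_inv pV).
rewrite VmatS invmx_rank1 // -/q.
set A := invmx _ in u sV *; set x := X _ in u *.
have -> : A *m x *m (x^T *m A) = (A *m x) *m (A *m x)^T by rewrite trmx_mul sV.
rewrite !qformE bformDm -scaleNr bformZm bform_rank1.
have dE y : dotv (A *m x) y = bform A x y by rewrite /dotv /bform trmx_mul sV.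
rewrite !dE !(bformDl, bformDr, bformZl, bformZr) (bformC S x sV) -/u.
have -> : bform A x x = q by [].
by field; rewrite gt_eqF // ltr_pwDl.
Qed.

(** The response vector is [V th] plus the noise sum minus the ridge bias [lam *: th]. *)
Lemma thetahat_subE lam th X eta t : 0 < lam ->
  thetahat lam th X eta t - th =
  invmx (Vmat lam X t) *m (noise_sum X eta t - lam *: th).
Proof.
move=> lam0; have uV := posmx_unit (posmx_Vmat X t lam0).
rewrite /thetahat; have -> : Wvec th X eta t = Vmat lam X t *m th + (noise_sum X eta t - lam *: th).
  rewrite /Wvec /Vmat /noise_sum mulmxDl mul_scalar_mx (addrC (lam *: th)) -addrA (addrC (lam *: th)) subrK.
  rewrite mulmx_suml -big_split /=; apply: eq_bigr => s _.
  rewrite /Yobs scalerDl; congr (_ + _).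
  rewrite -mulmxA [(X s)^T *m th]mx11_scalar mul_mx_scalar; congr (_ *: _).
  by rewrite /dotv -[LHS]trace_mx11 -mxtrace_tr trace_mx11 trmx_mul trmxK.
by rewrite mulmxDr mulKmx // addrC addKr.
Qed.

Lemma qform_Vmat_ge lam X t x : 0 < lam -> lam * dotv x x <= qform (Vmat lam X t) x.
Proof.
move=> lam0; elim: t => [|t IH].
  by rewrite Vmat0 qformE -scalemx1 bformZm -dotvE.
rewrite VmatS qformE bformDm bform_rank1 (le_trans IH) // lerDl -expr2 sqr_ge0 //.
Qed.

(** Inverts [lam I <= V] without spectral theory: for [y = V^-1 x] and [q = <y, x>], Cauchy-Schwarz
    gives [lam q^2 <= lam |y|^2 |x|^2 <= q |x|^2], and [q] is divided out. *)
Lemma qform_invVmat_le lam X t x : 0 < lam ->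
  lam * qform (invmx (Vmat lam X t)) x <= dotv x x.
Proof.
move=> lam0; have pV := posmx_Vmat X t lam0.
have sV := proj1 (posmx_inv pV).
set A := invmx _ in sV *; pose y := A *m x.
have qy : qform (Vmat lam X t) y = dotv y x.
  by rewrite /qform /dotv -mulmxA mulKVmx // posmx_unit.
have qx : qform A x = dotv y x by rewrite /qform /dotv trmx_mul sV.
have := qform_Vmat_ge X t y lam0; rewrite qy -qx => h.
have CS := bform_CS (posmx1 R d) y x; rewrite !qformE -!dotvE -qx in CS.
have q0 : 0 <= qform A x by apply/qform_ge0/posmx_inv.
have [->|qn0] := eqVneq (qform A x) 0; first by rewrite mulr0 dotvv_ge0.
have qp : 0 < qform A x by rewrite lt_neqAle eq_sym qn0.
rewrite -(ler_pM2l qp) mulrCA -expr2.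
apply: le_trans (ler_wpM2l (ltW lam0) CS) _.
by rewrite mulrA ler_wpM2r ?dotvv_ge0.
Qed.

(** Cauchy-Schwarz in the norm of [V^-1], applied separately to the noise and to the ridge bias. *)
Lemma estimation_error lam th X eta t x : 0 < lam ->
  `|dotv (thetahat lam th X eta t) x - dotv th x| <=
  (Num.sqrt (qform (invmx (Vmat lam X t)) (noise_sum X eta t)) + Num.sqrt lam * enorm th) *
  Num.sqrt (qform (invmx (Vmat lam X t)) x).
Proof.
move=> lam0; have pV := posmx_Vmat X t lam0; have pA := posmx_inv pV.
have -> : dotv (thetahat lam th X eta t) x - dotv th x = dotv (thetahat lam th X eta t - th) x.
  by rewrite !dotvE bformDl bformNl.
rewrite thetahat_subE //; set A := invmx _ in pA *; set S := noise_sum _ _ _.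
have -> : dotv (A *m (S - lam *: th)) x = bform A S x - lam * bform A th x.
  by rewrite -bformZl -bformNl -bformDl /dotv /bform trmx_mul (proj1 pA).
rewrite (le_trans (ler_normB _ _)) // mulrDl lerD //; first exact: bform_CS_sqrt.
rewrite normrM (gtr0_norm lam0).
apply: le_trans (ler_wpM2l (ltW lam0) (bform_CS_sqrt pA _ _)) _.
rewrite mulrA ler_wpM2r ?sqrtr_ge0 //.
rewrite -[X in X * _ <= _](sqr_sqrtr (ltW lam0)) expr2 -mulrA ler_wpM2l ?sqrtr_ge0 //.
rewrite /enorm -sqrtrM ?(ltW lam0) // ler_wsqrtr //; exact: qform_invVmat_le.
Qed.

End RidgeRegression.

(** * Self-normalized concentration *)

Import HBNNSimple.

(** * Sub-Gaussian noise against history-measurable weights *)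

Section ConditionalSubgaussian.
Context {dO : measure_display} {O : measurableType dO} {R : realType}.
Variables (P : probability O R) (G : set (set O)).
Hypothesis mG : forall B, G B -> measurable B.

Lemma sub_sigma_measurable B : <<s G >> B -> measurable B.
Proof. by move: B; apply: smallest_sub; first exact: sigma_algebra_measurable. Qed.

Lemma sub_sigma_measurable_fun d' (T' : measurableType d') (f : O -> T') :
  measurable_fun [set: g_sigma_algebraType G] (f : g_sigma_algebraType G -> T') ->
  measurable_fun [set: O] f.
Proof. by move=> mf _ B mB; apply: sub_sigma_measurable; exact: mf. Qed.

Variables (r : R) (e : O -> R).
Hypothesis me : measurable_fun setT e.
Hypothesis sub_e : cond_subgaussian P <<s G >> r e.

(** Passes from indicators of history events to nonnegative weights: linearity for simple functions,
    then monotone convergence. *)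
Lemma cond_subgaussian_fun (l : R) (h : O -> R) : (forall w, 0 <= h w) ->
  measurable_fun [set: g_sigma_algebraType G] (h : g_sigma_algebraType G -> R) ->
  (\int[P]_w (h w * expR (l * e w))%:E <=
   (expR (l ^+ 2 * r ^+ 2 / 2))%:E * \int[P]_w (h w)%:E)%E.
Proof.
move=> h0 mh; set c := expR (_ / 2).
have mE : measurable_fun setT (fun w => expR (l * e w)).
  by apply: measurableT_comp => //; exact: measurable_funM.
have mh' : measurable_fun [set: O] h by exact: sub_sigma_measurable_fun.
have mEh : measurable_fun [set: g_sigma_algebraType G] (EFin \o h : g_sigma_algebraType G -> \bar R).
  exact/measurable_EFinP.
(* The approximation is taken over the generated sigma-algebra, so that the level sets of [hn n] are
   history events. *)
pose gn : {nnsfun g_sigma_algebraType G >-> R}^nat := nnsfun_approx measurableT mEh.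
pose hn n : O -> R := (gn n : g_sigma_algebraType G -> R).
have mhn n : measurable_fun [set: O] (hn n).
  by apply: sub_sigma_measurable_fun; exact: measurable_funPT.
have hn0 n w : 0 <= hn n w by exact: fun_ge0.
have hnh w : EFin \o hn ^~ w @ \oo --> (h w)%:E.
  by apply: (@cvg_nnsfun_approx _ _ _ _ measurableT _ mEh) => //= ? _; rewrite lee_fin.
have ndhn w : {homo (fun n => hn n w) : m n / (m <= n)%N >-> m <= n}.
  by move=> m n /(nd_nnsfun_approx measurableT mEh)/lefP; exact.
have hn_le n w : hn n w <= h w.
  rewrite -lee_fin -(cvg_lim _ (hnh w)) //=.
  apply: lime_ge; first by apply/cvg_ex; exists (h w)%:E; exact: hnh.
  by exists n => // m /= nm; rewrite lee_fin ndhn.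
have simple n : (\int[P]_w (hn n w * expR (l * e w))%:E <= c%:E * \int[P]_w (hn n w)%:E)%E.
  pose s : seq R := fset_set (range (hn n)).
  pose B y : set O := hn n @^-1` [set y].
  have GB y : <<s G >> (B y).
    have := @measurable_funPTI _ _ _ _ (gn n) [set y] (measurable_set1 y).
    exact.
  have mB y : measurable (B y) by exact: sub_sigma_measurable.
  have fin : finite_set (range (hn n)) by exact: (@fimfunP _ _ (gn n)).
  (* The cut at 0 is inactive on values of [hn n], but makes the coefficient nonnegative at every
     index, as integrating the sum requires. *)
  pose p y : R := Num.max 0 y.
  have p0 y : 0 <= p y by rewrite le_max lexx.
  have hnE w : hn n w = \sum_(y <- s) p y * \1_(B y) w.
    rewrite /hn fimfunE fsbig_finite //= big_seq [RHS]big_seq.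
    apply: eq_bigr => y; rewrite in_fset_set // => /set_mem [v _ <-].
    by rewrite /p max_r.
  have -> : (\int[P]_w (hn n w * expR (l * e w))%:E =
      \sum_(y <- s) (p y)%:E * \int[P]_(w in B y) (expR (l * e w))%:E)%E.
    rewrite (eq_integral (fun w => \sum_(y <- s) (p y)%:E * ((expR (l * e w))%:E * (\1_(B y) w)%:E))%E); last first.
      move=> w _; rewrite hnE mulr_suml -sumEFin.
      by apply: eq_bigr => y _; rewrite -!EFinM mulrAC mulrA.
    rewrite ge0_integral_sum //; last 2 first.
    - move=> y; apply/measurable_EFinP; apply: measurable_funM => //.
      exact: measurable_funM.
    - by move=> y w _; rewrite -!EFinM lee_fin !mulr_ge0 ?expR_ge0.
    apply: eq_bigr => y _.
    rewrite ge0_integralZl_EFin //; last first.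
      by apply/measurable_EFinP; exact: measurable_funM.
    congr (_ * _)%E; rewrite [RHS]integral_mkcond; apply: eq_integral => w _.
    by rewrite epatch_indic.
  have -> : (\int[P]_w (hn n w)%:E = \sum_(y <- s) (p y)%:E * P (B y))%E.
    rewrite (eq_integral (fun w => \sum_(y <- s) (p y)%:E * (\1_(B y) w)%:E)%E); last first.
      by move=> w _; rewrite hnE -sumEFin.
    rewrite ge0_integral_sum //; last 2 first.
    - by move=> y; apply/measurable_EFinP; exact: measurable_funM.
    - by move=> y w _; rewrite -!EFinM lee_fin !mulr_ge0.
    apply: eq_bigr => y _.
    rewrite ge0_integralZl_EFin //; last exact/measurable_EFinP.
    by rewrite integral_indic // setIT.
  rewrite ge0_sume_distrr; last first.
    by move=> y _; rewrite mule_ge0 // lee_fin.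
  apply: lee_sum => y _.
  by rewrite muleCA lee_wpmul2l ?lee_fin //; exact: sub_e.
have -> : (\int[P]_w (h w * expR (l * e w))%:E =
   \int[P]_w (limn (fun n => (hn n w * expR (l * e w))%:E)))%E.
  apply: eq_integral => w _; apply/esym/cvg_lim => //.
  rewrite (_ : (fun n => _) = (fun n => (EFin \o hn ^~ w) n * (expR (l * e w))%:E)%E); last first.
    by apply/funext => n /=; rewrite EFinM.
  by rewrite EFinM; apply: cvgeZr => //; exact: hnh.
rewrite monotone_convergence //; last 3 first.
- by move=> n; apply/measurable_EFinP; exact: measurable_funM.
- by move=> n w _; rewrite lee_fin mulr_ge0 ?expR_ge0.
- by move=> w _ m n mn; rewrite lee_fin ler_wpM2r ?expR_ge0 // ndhn.
apply: lime_le.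
  apply: ereal_nondecreasing_is_cvgn => m n mn; apply: ge0_le_integral => //.
  - by move=> w _; rewrite lee_fin mulr_ge0 ?expR_ge0.
  - by apply/measurable_EFinP; exact: measurable_funM.
  - by apply/measurable_EFinP; exact: measurable_funM.
  - by move=> w _; rewrite lee_fin ler_wpM2r ?expR_ge0 // ndhn.
apply: nearW => n; apply: le_trans (simple n) _.
rewrite lee_wpmul2l ?lee_fin ?expR_ge0 //; apply: ge0_le_integral => //.
- by move=> w _; rewrite lee_fin.
- exact/measurable_EFinP.
- exact/measurable_EFinP.
- by move=> w _; rewrite lee_fin.
Qed.

End ConditionalSubgaussian.

(** * One-dimensional Gaussian mixtures *)

Section GaussianMixture.
Context {R : realType}.
Implicit Types (sg u q l e : R).

(* For [0 < q] this is the density at [l] of the normal law of mean [u / sg ^+ 2] and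
   variance [q / sg ^+ 2]; real powers make it measurable in [(u, q, l)] jointly. *)
Definition mix_density sg u q l : R :=
  (q / sg ^+ 2 * pi *+ 2) `^ (- 2^-1) *
  expR (- (l - u / sg ^+ 2) ^+ 2 * (q / sg ^+ 2 *+ 2) `^ (- 1)).

Lemma mix_density_ge0 sg u q l : 0 <= mix_density sg u q l.
Proof. by rewrite mulr_ge0 ?powR_ge0 ?expR_ge0. Qed.

Lemma mix_densityE sg u q l : 0 < sg -> 0 < q ->
  mix_density sg u q l = normal_pdf (u / sg ^+ 2) (Num.sqrt q / sg) l.
Proof.
move=> sg0 q0; have s0 : Num.sqrt q / sg != 0 by rewrite gt_eqF // divr_gt0 ?sqrtr_gt0.
have v0 : 0 < q / sg ^+ 2 by rewrite divr_gt0 ?exprn_gt0.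
rewrite normal_pdfE // /normal_peak /normal_fun /mix_density expr_div_n sqr_sqrtr ?ltW //.
have v2 : 0 <= q / sg ^+ 2 * pi *+ 2 by rewrite mulrn_wge0 // mulr_ge0 ?pi_ge0 // ltW.
have v1 : 0 <= q / sg ^+ 2 *+ 2 by rewrite mulrn_wge0 // ltW.
by rewrite !powRN powR12_sqrt // powRr1.
Qed.

Lemma measurable_mix_density dT (T : measurableType dT) sg (u q l : T -> R) :
  measurable_fun setT u -> measurable_fun setT q -> measurable_fun setT l ->
  measurable_fun setT (fun w => mix_density sg (u w) (q w) (l w)).
Proof.
move=> mu mq ml; apply: measurable_funM.
  apply: (measurableT_comp (measurable_powR _)).
  rewrite (_ : (fun _ => _) = (fun w => q w * ((sg ^+ 2)^-1 * pi *+ 2))); last first.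
    by apply/funext => w; rewrite [RHS]mulrnAr mulrA.
  exact: measurable_funM.
apply: measurableT_comp => //; apply: measurable_funM.
  apply: measurableT_comp => //; apply: measurable_funX; apply: measurable_funB => //.
  exact: measurable_funM.
apply: (measurableT_comp (measurable_powR _)).
rewrite (_ : (fun _ => _) = (fun w => q w * ((sg ^+ 2)^-1 *+ 2))); last first.
  by apply/funext => w; rewrite [RHS]mulrnAr.
exact: measurable_funM.
Qed.

Lemma integral_mix_density sg u q : 0 < sg -> 0 < q ->
  (\int[lebesgue_measure]_l (mix_density sg u q l)%:E = 1)%E.
Proof.
move=> sg0 q0; rewrite -(integral_normal_pdf (u / sg ^+ 2) (Num.sqrt q / sg)).
by apply: eq_integral => l _; rewrite mix_densityE.
Qed.

(** Completing the square: the integrand is a constant times another normal density, whose integral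
    is 1. *)
Lemma integral_mix_density_expR sg u q e : 0 < sg -> 0 < q ->
  (\int[lebesgue_measure]_l (mix_density sg u q l * expR (l * e - l ^+ 2 * sg ^+ 2 / 2))%:E =
  ((Num.sqrt (1 + q))^-1 *
     expR ((2 * e * u + e ^+ 2 * q - u ^+ 2) / (1 + q) / (2 * sg ^+ 2)))%:E)%E.
Proof.
move=> sg0 q0; have q1 : 0 < 1 + q by lra.
set C := _ * expR _.
have C0 : 0 <= C by rewrite mulr_ge0 ?expR_ge0 ?invr_ge0 ?sqrtr_ge0.
(* Posterior parameters: the precision [sg ^+ 2 / q] grows by [sg ^+ 2], and the mean becomes
   [m' / sg ^+ 2]. *)
pose m' := (e * q + u) / (1 + q); pose q' := q / (1 + q).
have q'0 : 0 < q' by rewrite divr_gt0.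
transitivity (\int[lebesgue_measure]_l (C%:E * (mix_density sg m' q' l)%:E))%E; last first.
  rewrite ge0_integralZl_EFin ?integral_mix_density ?mule1 //.
  - by move=> l _; rewrite lee_fin mix_density_ge0.
  - by apply/measurable_EFinP; exact: measurable_mix_density.
apply: eq_integral => l _; rewrite -EFinM; congr EFin.
rewrite /mix_density /C.
have v0 : 0 < q / sg ^+ 2 by rewrite divr_gt0 ?exprn_gt0.
have v'0 : 0 < q' / sg ^+ 2 by rewrite divr_gt0 ?exprn_gt0.
have pos (v : R) : 0 < v -> 0 <= v * pi *+ 2 by move=> ?; rewrite mulrn_wge0 // mulr_ge0 ?pi_ge0 // ltW.
have pos1 (v : R) : 0 < v -> 0 <= v *+ 2 by move=> ?; rewrite mulrn_wge0 // ltW.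
rewrite !powRN !powR12_sqrt ?pos // !powRr1 ?pos1 //.
have -> : q / sg ^+ 2 * pi *+ 2 = (1 + q) * (q' / sg ^+ 2 * pi *+ 2).
  by rewrite /q'; field; rewrite !gt_eqF.
rewrite (sqrtrM _ (ltW q1)) invfM -!mulrA; congr (_ * _).
rewrite [RHS]mulrCA; congr (_ * _); rewrite -!expRD; congr expR.
rewrite /m' /q'; field; rewrite !gt_eqF //.
Qed.

End GaussianMixture.

(** * One step of the supermartingale *)

Section SupermartingaleStep.
Context {dO : measure_display} {O : measurableType dO} {R : realType}.
Variables (P : probability O R) (G : set (set O)).
Hypothesis mG : forall B, G B -> measurable B.
Local Notation GO := (g_sigma_algebraType G).

(** [G] stands for the history just before the noise [e], and [H] for the current value of the
    process. [sg] is kept apart from [r] because the mixture needs a positive parameter even when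
    [r = 0]. *)
Lemma supermartingale_step (r sg : R) (e H q u : O -> R) :
  0 <= r -> r <= sg -> 0 < sg ->
  measurable_fun setT e -> cond_subgaussian P <<s G >> r e ->
  (forall w, 0 <= H w) -> (forall w, 0 <= q w) -> (forall w, q w = 0 -> u w = 0) ->
  measurable_fun [set: GO] (H : GO -> R) ->
  measurable_fun [set: GO] (q : GO -> R) ->
  measurable_fun [set: GO] (u : GO -> R) ->
  (\int[P]_w (H w * ((Num.sqrt (1 + q w))^-1 *
     expR ((2 * e w * u w + e w ^+ 2 * q w - u w ^+ 2) / (1 + q w) / (2 * sg ^+ 2))))%:E
   <= \int[P]_w (H w)%:E)%E.
Proof.
move=> r0 rsg sg0 me sub_e H0 q0 qu mH mq mu.
(* Off [D] the variance is 0 and there is no density, but there [u] vanishes too and the factor is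
   1; only the part of [H] on [D] is mixed. *)
pose D : set O := [set w | 0 < q w].
have GD : measurable (D : set GO).
  rewrite -[X in measurable X]setTI.
  have -> : D = (q : GO -> R) @^-1` [set x | 0 < x] by [].
  by rewrite -set_itvoy; exact: mq.
have mD : measurable D by apply: sub_sigma_measurable mG _ GD.
pose H1 w := H w * \1_D w; pose H2 w := H w * \1_(~` D) w.
have H10 w : 0 <= H1 w by rewrite mulr_ge0.
have H20 w : 0 <= H2 w by rewrite mulr_ge0.
have GH1 : measurable_fun [set: GO] (H1 : GO -> R).
  by apply: measurable_funM => //; exact: measurable_indic.
have GH2 : measurable_fun [set: GO] (H2 : GO -> R).
  by apply: measurable_funM => //; apply: measurable_indic; exact: measurableC.
have mo (f : O -> R) : measurable_fun [set: GO] (f : GO -> R) -> measurable_fun [set: O] f.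
  exact: sub_sigma_measurable_fun.
have HE w : H w = H1 w + H2 w.
  have -> : H2 w = H w * (1 - \1_D w) by rewrite /H2 !indicE in_setC; case: (w \in D); rewrite /= ?subrr ?subr0.
  by rewrite /H1; ring.
have mo1 := mo _ GH1; have mo2 := mo _ GH2; have moq := mo _ mq; have mou := mo _ mu.
pose F (z : O * R) : R := H1 z.1 * mix_density sg (u z.1) (q z.1) z.2.
pose E (z : O * R) : R := expR (z.2 * e z.1 - z.2 ^+ 2 * sg ^+ 2 / 2).
have F0 z : 0 <= F z by rewrite mulr_ge0 ?mix_density_ge0.
have E0 z : 0 <= E z by exact: expR_ge0.
have mF : measurable_fun [set: O * R] F.
  apply: measurable_funM; first exact: measurableT_comp.
  by apply: measurable_mix_density => //; exact: measurableT_comp.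
have mE : measurable_fun [set: O * R] E.
  apply: measurableT_comp => //; apply: measurable_funB.
    by apply: measurable_funM => //; exact: measurableT_comp.
  by apply: measurable_funM => //; apply: measurable_funM => //; exact: measurable_funX.
(* Integrating out the density recovers [H1], so both sides of the goal become iterated
   integrals. *)
have innerF w : (\int[lebesgue_measure]_l (F (w, l))%:E = (H1 w)%:E)%E.
  rewrite /F /H1 /= indicE; case: (boolP (w \in D)) => [/set_mem wD|_]; last first.
    by rewrite mulr0; under eq_integral do rewrite mul0r; rewrite integral0.
  under eq_integral do rewrite EFinM.
  rewrite ge0_integralZl_EFin ?integral_mix_density ?mule1 ?mulr1 //.
  - by move=> l _; rewrite lee_fin mix_density_ge0.
  - by apply/measurable_EFinP; exact: measurable_mix_density.
have innerFE w : (\int[lebesgue_measure]_l (F (w, l) * E (w, l))%:E =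
   (H1 w * ((Num.sqrt (1 + q w))^-1 *
     expR ((2 * e w * u w + e w ^+ 2 * q w - u w ^+ 2) / (1 + q w) / (2 * sg ^+ 2))))%:E)%E.
  rewrite /F /H1 /= indicE; case: (boolP (w \in D)) => [/set_mem wD|_]; last first.
    by rewrite mulr0; under eq_integral do rewrite !mul0r; rewrite integral0 mul0r.
  under eq_integral do rewrite -mulrA EFinM.
  rewrite mulr1 ge0_integralZl_EFin //.
  - by rewrite /E /= integral_mix_density_expR // -EFinM.
  - by move=> l _; rewrite lee_fin mulr_ge0 ?mix_density_ge0.
  - apply/measurable_EFinP; apply: measurable_funM; first exact: measurable_mix_density.
    exact: (measurableT_comp mE).
rewrite (eq_integral (fun w => (\int[lebesgue_measure]_l (F (w, l) * E (w, l))%:E + (H2 w)%:E)%E)); last first.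
  move=> w _; rewrite innerFE -EFinD HE mulrDl; congr (_ + _)%:E.
  rewrite /H2 indicE; case: (boolP (w \in ~` D)) => [/set_mem /negP wD|_]; last first.
    by rewrite mulr0 mul0r.
  have qw : q w = 0 by apply/eqP; rewrite eq_le q0 andbT leNgt.
  by rewrite qw (qu _ qw) expr0n /= !mulr0 add0r subr0 !mul0r expR0 addr0 sqrtr1 invr1 !mulr1.
rewrite (eq_integral (fun w => (\int[lebesgue_measure]_l (F (w, l))%:E + (H2 w)%:E)%E) (fun w => (H w)%:E)); last first.
  by move=> w _; rewrite innerF -EFinD HE.
have mFE : measurable_fun [set: O * R] (fun z => (F z * E z)%:E).
  by apply/measurable_EFinP; exact: measurable_funM.
have mF' : measurable_fun [set: O * R] (fun z => (F z)%:E) by exact/measurable_EFinP.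
have F0' z : (0 <= (F z)%:E)%E by rewrite lee_fin.
have FE0' z : (0 <= (F z * E z)%:E)%E by rewrite lee_fin mulr_ge0.
have mI2 : measurable_fun [set: O] (fun w => (H2 w)%:E) by exact/measurable_EFinP.
have H20' w : [set: O] w -> (0 <= (H2 w)%:E)%E by rewrite lee_fin.
rewrite ge0_integralD //; first last.
- exact: (measurable_fun_fubini_tonelli_F (m2 := lebesgue_measure) (fun z => (F z * E z)%:E)).
- by move=> w _; apply: integral_ge0 => l _.
rewrite [leRHS]ge0_integralD //; first last.
- exact: (measurable_fun_fubini_tonelli_F (m2 := lebesgue_measure) (fun z => (F z)%:E)).
- by move=> w _; apply: integral_ge0 => l _.
rewrite leeD2r //.
(* With [l] integrated last, it suffices to compare at each fixed [l], where [F] is a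
   history-measurable weight. *)
have swap (f : O * R -> R) : measurable_fun [set: O * R] (fun z => (f z)%:E) ->
    (forall z, 0 <= (f z)%:E)%E ->
    (\int[P]_w \int[lebesgue_measure]_l (f (w, l))%:E =
     \int[lebesgue_measure]_l \int[P]_w (f (w, l))%:E)%E.
  by move=> mf f0; exact: (fubini_tonelli (m1 := P) (m2 := lebesgue_measure) (fun z => (f z)%:E)).
rewrite (swap (fun z => F z * E z)) // (swap F) //.
apply: ge0_le_integral => //.
- by move=> l _; apply: integral_ge0.
- exact: (measurable_fun_fubini_tonelli_G (m1 := P) (fun z => (F z * E z)%:E)).
- exact: (measurable_fun_fubini_tonelli_G (m1 := P) (fun z => (F z)%:E)).
move=> l _.
have GF : measurable_fun [set: GO] ((fun w => F (w, l)) : GO -> R).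
  by apply: measurable_funM => //; exact: measurable_mix_density.
have moF := mo _ GF.
have mEl : measurable_fun [set: O] (fun w => expR (l * e w)).
  by apply: measurableT_comp => //; exact: measurable_funM.
rewrite (eq_integral (fun w => (expR (- (l ^+ 2 * sg ^+ 2 / 2)))%:E * (F (w, l) * expR (l * e w))%:E)%E); last first.
  by move=> w _; rewrite -EFinM /E /= expRD mulrA mulrC.
rewrite ge0_integralZl_EFin ?expR_ge0 //; last 2 first.
- by move=> w _; rewrite lee_fin mulr_ge0 ?expR_ge0.
- by apply/measurable_EFinP; exact: measurable_funM.
apply: le_trans (lee_wpmul2l _ (cond_subgaussian_fun mG me sub_e l (fun w => F0 (w, l)) GF)) _.
  by rewrite lee_fin expR_ge0.
(* The two exponentials combine to [expR (l ^+ 2 * (r ^+ 2 - sg ^+ 2) / 2)], at most 1 since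
   [r <= sg]. *)
rewrite muleA -EFinM -expRD -[leRHS]mul1e lee_wpmul2r //.
  by apply: integral_ge0.
rewrite lee_fin -[leRHS]expR0 ler_expR addrC subr_le0.
rewrite ler_wpM2r ?invr_ge0 ?ler0n // ler_wpM2l ?sqr_ge0 //.
by rewrite ler_sqr ?nnegrE // (le_trans r0).
Qed.

End SupermartingaleStep.

(** * Measurability of matrix-valued maps *)

Section MeasurableMatrix.
Context {dT : measure_display} {T : measurableType dT} {R : realType}.

(** Stated over an arbitrary space, so as to serve both for the full sigma-algebra and for the
    histories. *)
Definition measurable_mx {m n} (A : T -> 'M[R]_(m, n)) :=
  forall i j, measurable_fun setT (fun w => A w i j).

Lemma measurable_mulmx m n p (A : T -> 'M[R]_(m, n)) (B : T -> 'M[R]_(n, p)) :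
  measurable_mx A -> measurable_mx B -> measurable_mx (fun w => A w *m B w).
Proof.
move=> mA mB i j; under eq_fun do rewrite mxE.
by apply: measurable_sum => k; exact: measurable_funM.
Qed.

Lemma measurable_trmx m n (A : T -> 'M[R]_(m, n)) :
  measurable_mx A -> measurable_mx (fun w => (A w)^T).
Proof. by move=> mA i j; under eq_fun do rewrite mxE; exact: mA. Qed.

Lemma measurable_det n (A : T -> 'M[R]_n) :
  measurable_mx A -> measurable_fun setT (fun w => \det (A w)).
Proof.
move=> mA; apply: measurable_sum => s; apply: measurable_funM => //.
by apply: measurable_prod => i _; exact: mA.
Qed.

Lemma measurable_fun_inv (f : T -> R) : (forall w, 0 < f w) ->
  measurable_fun setT f -> measurable_fun setT (fun w => (f w)^-1).
Proof.
move=> f0 mf; rewrite (_ : (fun _ => _) = (fun w => f w `^ (- 1))).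
  exact: (measurableT_comp (measurable_powR _)).
by apply/funext => w; rewrite powR_inv1 // ltW.
Qed.

Lemma measurable_fun_sqrt (f : T -> R) : (forall w, 0 <= f w) ->
  measurable_fun setT f -> measurable_fun setT (fun w => Num.sqrt (f w)).
Proof.
move=> f0 mf; rewrite (_ : (fun _ => _) = (fun w => f w `^ (2^-1))).
  exact: (measurableT_comp (measurable_powR _)).
by apply/funext => w; rewrite powR12_sqrt.
Qed.

(** Each entry is a cofactor divided by the determinant, which is positive. *)
Lemma measurable_invmx n (A : T -> 'M[R]_n) : (forall w, posmx (A w)) ->
  measurable_mx A -> measurable_mx (fun w => invmx (A w)).
Proof.
move=> pA mA i j.
rewrite (_ : (fun _ => _) =
  (fun w => (\det (A w))^-1 * ((-1) ^+ (j + i) * \det (row' j (col' i (A w)))))); last first.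
  by apply/funext => w; rewrite /invmx posmx_unit // !mxE.
apply: measurable_funM.
  apply: measurable_fun_inv; last exact: measurable_det.
  by move=> w; have [] := posmx_det (pA w).
apply: measurable_funM => //; apply: measurable_det => k l.
by under eq_fun do rewrite !mxE; exact: mA.
Qed.

Lemma measurable_bform n (A : T -> 'M[R]_n) (x y : T -> 'cV[R]_n) :
  measurable_mx A -> measurable_mx x -> measurable_mx y ->
  measurable_fun setT (fun w => bform (A w) (x w) (y w)).
Proof.
move=> mA mx my; rewrite /bform; apply: measurable_mulmx => //.
by apply: measurable_mulmx => //; exact: measurable_trmx.
Qed.

Lemma measurable_dotv n (x y : T -> 'cV[R]_n) :
  measurable_mx x -> measurable_mx y ->
  measurable_fun setT (fun w => dotv (x w) (y w)).
Proof. by move=> mx my; apply: measurable_mulmx => //; exact: measurable_trmx. Qed.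

Lemma measurable_Vmat n lam (X : nat -> T -> 'cV[R]_n) t :
  (forall s, (1 <= s <= t)%N -> measurable_mx (X s)) ->
  measurable_mx (fun w => Vmat lam (X ^~ w) t).
Proof.
elim: t => [|t IH] mX i j.
  by under eq_fun do rewrite Vmat0; exact: measurable_cst.
under eq_fun do rewrite VmatS mxE.
apply: measurable_funD; first by apply: IH => s /andP[s1 st]; apply: mX; rewrite s1 ltnW.
have mXt : measurable_mx (X t.+1) by apply: mX; rewrite ltnSn.
by apply: measurable_mulmx => //; exact: measurable_trmx.
Qed.

Lemma measurable_noise_sum n (X : nat -> T -> 'cV[R]_n) (eta : nat -> T -> R) t :
  (forall s, (1 <= s <= t)%N -> measurable_mx (X s)) ->
  (forall s, (1 <= s <= t)%N -> measurable_fun setT (eta s)) ->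
  measurable_mx (fun w => noise_sum (X ^~ w) (eta ^~ w) t).
Proof.
elim: t => [|t IH] mX me i j.
  by under eq_fun do rewrite /noise_sum big_geq // mxE; exact: measurable_cst.
under eq_fun do rewrite noise_sumS 2!mxE.
apply: measurable_funD.
  by apply: IH => s /andP[s1 st]; [apply: mX|apply: me]; rewrite s1 ltnW.
by apply: measurable_funM; [apply: me|apply: mX]; rewrite ltnSn.
Qed.

End MeasurableMatrix.

(** * The mixture supermartingale and its tail *)

Section SelfNormalizedMartingale.
Context {dO : measure_display} {O : measurableType dO} {R : realType} {d : nat}.
Variables (P : probability O R) (th : 'cV[R]_d) (X : nat -> O -> 'cV[R]_d) (eta : nat -> O -> R).
Variables (r lam : R).
Hypothesis lam0 : 0 < lam.
Hypothesis r0 : 0 <= r.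
Hypothesis mX : forall t i, measurable_fun setT (fun w => X t w i 0).
Hypothesis meta : forall t, measurable_fun setT (eta t).
Hypothesis sub_eta : forall t, (1 <= t)%N ->
  cond_subgaussian P (history_sigma th X eta t) r (eta t).

(** The generators of [history_sigma], named so that the generated sigma-algebra can serve as a
    measurable space. *)
Definition history_gen (t : nat) : set (set O) :=
  [set B | exists s i (C : set R), (1 <= s <= t)%N /\ measurable C /\
                 B = [set w | C (X s w i 0)]]
  `|` [set B | exists s (C : set R), (1 <= s < t)%N /\ measurable C /\
                 B = [set w | C (Yobs th (X ^~ w) (eta ^~ w) s)]].

Let mxX s : measurable_mx (X s).
Proof. by move=> i j; rewrite ord1; exact: mX. Qed.

Lemma measurable_Yobs s : measurable_fun setT (fun w => Yobs th (X ^~ w) (eta ^~ w) s).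
Proof. by apply: measurable_funD => //; apply: measurable_dotv. Qed.

Lemma history_gen_measurable t B : history_gen t B -> measurable B.
Proof.
case=> [[s [i [C [_ [mC ->]]]]]|[s [C [_ [mC ->]]]]]; rewrite -[X in measurable X]setTI.
  exact: mX.
exact: measurable_Yobs.
Qed.

Local Notation GO t := (g_sigma_algebraType (history_gen t)).

Lemma history_measurable_X t s : (1 <= s <= t)%N ->
  measurable_mx (X s : GO t -> 'cV[R]_d).
Proof.
move=> st i j; rewrite ord1 => _ C mC; rewrite setTI.
by apply: sub_sigma_algebra; left; exists s, i, C.
Qed.

(** Past noise is recovered as the observation minus the mean reward of the action. *)
Lemma history_measurable_eta t s : (1 <= s < t)%N ->
  measurable_fun [set: GO t] (eta s : GO t -> R).
Proof.
move=> /andP[s1 st].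
rewrite (_ : eta s = (fun w => Yobs th (X ^~ w) (eta ^~ w) s) \- (fun w => dotv th (X s w))).
  apply: measurable_funB.
    move=> _ C mC; rewrite setTI.
    by apply: sub_sigma_algebra; right; exists s, C; rewrite s1 st.
  by apply: measurable_dotv => //; apply: history_measurable_X; rewrite s1 ltnW.
by apply/funext => w /=; rewrite /Yobs addrC addKr.
Qed.

(** Closed form of the mixture of [exp (<x, S_t> - sg^2 x^T (V_t - lam I) x / 2)] over a centred
    Gaussian [x] of covariance [I / (sg^2 lam)]. That integral is never formed, only the one-step
    factors are. *)
Definition mixture_mart (sg : R) (t : nat) (w : O) : R :=
  (Num.sqrt (\det (Vmat lam (X ^~ w) t) / lam ^+ d))^-1 *
  expR (qform (invmx (Vmat lam (X ^~ w) t)) (noise_sum (X ^~ w) (eta ^~ w) t) / (2 * sg ^+ 2)).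

Lemma det_ratio_gt0 t w : 0 < \det (Vmat lam (X ^~ w) t) / lam ^+ d.
Proof. by rewrite divr_gt0 ?exprn_gt0 ?det_Vmat_gt0. Qed.

Lemma mixture_mart_ge0 sg t w : 0 <= mixture_mart sg t w.
Proof. by rewrite mulr_ge0 ?expR_ge0 // invr_ge0 sqrtr_ge0. Qed.

Lemma mixture_martS sg t w : 0 < sg ->
  let q := weight lam (X ^~ w) t in
  let u := bform (invmx (Vmat lam (X ^~ w) t)) (X t.+1 w) (noise_sum (X ^~ w) (eta ^~ w) t) in
  let e := eta t.+1 w in
  mixture_mart sg t.+1 w = mixture_mart sg t w * ((Num.sqrt (1 + q))^-1 *
     expR ((2 * e * u + e ^+ 2 * q - u ^+ 2) / (1 + q) / (2 * sg ^+ 2))).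
Proof.
move=> sg0 q u e; rewrite /mixture_mart noise_sumS qform_inv_update // det_VmatS //.
rewrite mulrAC sqrtrM ?(ltW (det_ratio_gt0 _ _)) // invfM mulrDl expRD.
by rewrite -!mulrA; congr (_ * _); rewrite mulrCA.
Qed.

(** The map [f] lets the identity on [O] be taken from the full sigma-algebra or from a history. *)
Lemma mixture_mart_measurable sg t dT (T : measurableType dT) (f : T -> O) :
  (forall s, (1 <= s <= t)%N -> measurable_mx (fun w => X s (f w))) ->
  (forall s, (1 <= s <= t)%N -> measurable_fun setT (fun w => eta s (f w))) ->
  measurable_fun setT (fun w => mixture_mart sg t (f w)).
Proof.
move=> mXf mef.
have mV : measurable_mx (fun w => Vmat lam (X ^~ (f w)) t).
  exact: (@measurable_Vmat _ _ _ _ lam (fun s w => X s (f w))).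
have mI : measurable_mx (fun w => invmx (Vmat lam (X ^~ (f w)) t)).
  by apply: measurable_invmx => // w; exact: posmx_Vmat.
have mS : measurable_mx (fun w => noise_sum (X ^~ (f w)) (eta ^~ (f w)) t).
  exact: (@measurable_noise_sum _ _ _ _ (fun s w => X s (f w)) (fun s w => eta s (f w))).
apply: measurable_funM.
  apply: measurable_fun_inv; first by move=> w; rewrite sqrtr_gt0 det_ratio_gt0.
  apply: measurable_fun_sqrt; first by move=> w; rewrite ltW ?det_ratio_gt0.
  by apply: measurable_funM => //; exact: measurable_det.
apply: measurableT_comp => //; apply: measurable_funM => //.
exact: measurable_bform.
Qed.

(** Induction from the constant 1 at time 0. The history of round [t.+1] contains [X t.+1] and the
    noises before [eta t.+1], so the current value, [q] and [u] are known in the step. *)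
Lemma expectation_mixture_mart sg t : r <= sg -> 0 < sg ->
  (\int[P]_w (mixture_mart sg t w)%:E <= 1)%E.
Proof.
move=> rsg sg0; elim: t => [|t IH].
  under eq_integral => w _.
    rewrite /mixture_mart Vmat0 det_scalar divff ?expf_neq0 ?gt_eqF //.
    rewrite sqrtr1 invr1 mul1r /noise_sum big_geq // qformE bform0r mul0r expR0.
    over.
  by rewrite integral_cst // mul1e probability_le1.
apply: le_trans IH.
under eq_integral do rewrite mixture_martS //.
have mXt s : (1 <= s <= t)%N -> measurable_mx (X s : GO t.+1 -> 'cV[R]_d).
  by move=> /andP[s1 st]; apply: history_measurable_X; rewrite s1 ltnW.
have met s : (1 <= s <= t)%N -> measurable_fun [set: GO t.+1] (eta s : GO t.+1 -> R).
  by move=> ?; exact: history_measurable_eta.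
have mV : measurable_mx ((fun w => invmx (Vmat lam (X ^~ w) t)) : GO t.+1 -> 'M[R]_d).
  apply: measurable_invmx; first by move=> w; exact: posmx_Vmat.
  exact: measurable_Vmat.
have mX1 : measurable_mx (X t.+1 : GO t.+1 -> 'cV[R]_d).
  by apply: history_measurable_X; rewrite ltnSn.
apply: (supermartingale_step (@history_gen_measurable t.+1) r0 rsg sg0 (meta t.+1)
          (sub_eta (ltn0Sn t))).
- by move=> w; exact: mixture_mart_ge0.
- by move=> w; exact: weight_ge0.
- move=> w /eqP; rewrite qform_eq0; last exact/posmx_inv/posmx_Vmat.
  by move=> /eqP ->; rewrite bform0l.
- exact: (@mixture_mart_measurable _ _ _ (GO t.+1) id).
- exact: measurable_bform.
- by apply: measurable_bform => //; exact: measurable_noise_sum.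
Qed.

(** Markov's inequality: with [D] in place of the random determinant, the process on [bad] is at
    least the constant in front of [P bad]. *)
Lemma mixture_tail sg D z t : r <= sg -> 0 < sg -> 0 < D ->
  (forall w, \det (Vmat lam (X ^~ w) t) / lam ^+ d <= D) ->
  let bad := [set w | z < qform (invmx (Vmat lam (X ^~ w) t)) (noise_sum (X ^~ w) (eta ^~ w) t)] in
  measurable bad /\
  (((Num.sqrt D)^-1 * expR (z / (2 * sg ^+ 2)))%:E * P bad <= 1)%E.
Proof.
move=> rsg sg0 D0 detD bad.
have mbad : measurable bad.
  rewrite -[X in measurable X]setTI.
  have -> : bad = (fun w => qform (invmx (Vmat lam (X ^~ w) t)) (noise_sum (X ^~ w) (eta ^~ w) t))
    @^-1` [set` `]z, +oo[] by rewrite set_itvoy.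
  have mf : measurable_fun setT (fun w => qform (invmx (Vmat lam (X ^~ w) t)) (noise_sum (X ^~ w) (eta ^~ w) t)).
    apply: measurable_bform; [|exact: measurable_noise_sum..].
    apply: measurable_invmx; first by move=> w; exact: posmx_Vmat.
    exact: measurable_Vmat.
  exact: mf.
split=> //; set k := _ * expR _.
have k0 : 0 <= k by rewrite mulr_ge0 ?expR_ge0 // invr_ge0 sqrtr_ge0.
apply: le_trans (expectation_mixture_mart t rsg sg0).
rewrite -[bad]setIT -integral_indic // -ge0_integralZl_EFin //; last first.
  exact/measurable_EFinP.
apply: ge0_le_integral => //.
- by move=> w _; rewrite -EFinM lee_fin mulr_ge0.
- by apply/measurable_EFinP; exact: measurable_funM.
- by apply/measurable_EFinP; exact: (@mixture_mart_measurable _ _ _ O id).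
move=> w _; rewrite -EFinM lee_fin indicE.
case: (boolP (w \in bad)) => [/set_mem wb|_]; last by rewrite mulr0 mixture_mart_ge0.
rewrite mulr1 /k /mixture_mart ler_pM ?expR_ge0 ?invr_ge0 ?sqrtr_ge0 //.
  by rewrite lef_pV2 ?posrE ?sqrtr_gt0 ?det_ratio_gt0 // ler_wsqrtr.
by rewrite ler_expR ler_wpM2r ?ltW // invr_gt0 mulr_gt0 // exprn_gt0.
Qed.

(** The quantity under the square root in [beta_round] at round [t.+1], where [1 / gamma] is
    [t.+1%:R ^+ 2]. *)
Definition log_radius (L : R) (t : nat) : R :=
  d%:R * ln ((1 + t%:R * L ^+ 2 / lam) * (t.+1)%:R ^+ 2).

(** The extra 1 in the threshold pays for a parameter [sg] above [r]; it is later absorbed by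
    [1 <= Num.sqrt lam * S]. *)
Lemma confidence_failure (L : R) t : (1 <= d)%N ->
  (forall w s, (1 <= s <= t)%N -> enorm (X s w) <= L) ->
  let bad := [set w | r ^+ 2 * log_radius L t + 1 <
     qform (invmx (Vmat lam (X ^~ w) t)) (noise_sum (X ^~ w) (eta ^~ w) t)] in
  measurable bad /\ (P bad <= ((t.+1)%:R^-1)%:E)%E.
Proof.
move=> d1 XL bad; set B := log_radius L t in bad *.
set a := 1 + t%:R * L ^+ 2 / lam.
have a1 : 1 <= a by rewrite lerDl divr_ge0 ?(ltW lam0) // mulr_ge0 ?sqr_ge0.
have a0 : 0 < a by rewrite (lt_le_trans _ a1).
have t1 : (1 : R) <= t.+1%:R by rewrite ler1n.
have BE : B = d%:R * ln a + 2 * (d%:R * ln t.+1%:R).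
  rewrite /B /log_radius lnM ?posrE ?exprn_gt0 // lnXn // mulrDr; congr (_ + _).
  by rewrite -[ln _ *+ 2]mulr_natl mulrCA.
have B0 : 0 <= B by rewrite BE addr_ge0 ?mulr_ge0 ?ln_ge0.
(* Any [sg > r] with [sg ^+ 2 * B <= r ^+ 2 * B + 1] works; [sg = r] would fail for [r = 0]. *)
pose sg := Num.sqrt (r ^+ 2 + (B + 1)^-1).
have B1 : 0 < B + 1 by lra.
have sg2 : 0 < r ^+ 2 + (B + 1)^-1 by rewrite ltr_wpDl ?sqr_ge0 ?invr_gt0.
have sg0 : 0 < sg by rewrite sqrtr_gt0.
have rsg : r <= sg.
  rewrite -[X in X <= _](ger0_norm r0) -sqrtr_sqr ler_wsqrtr //.
  by rewrite lerDl invr_ge0 ltW.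
have detD w : \det (Vmat lam (X ^~ w) t) / lam ^+ d <= a ^+ d.
  by apply: det_ratio_le => // s; exact: XL.
have [mbad tail] := mixture_tail (r ^+ 2 * B + 1) rsg sg0 (exprn_gt0 d a0) detD.
split=> //; rewrite -/bad in tail.
set k := _ * expR _ in tail.
(* In [B / 2] the part [d * ln a / 2] cancels the square root of [a ^+ d], and the rest,
   [d * ln (t + 1)], is at least [ln (t + 1)] as [d >= 1]. *)
have tk : t.+1%:R <= k.
  rewrite /k; have -> : Num.sqrt (a ^+ d) = expR (d%:R * ln a / 2).
    have -> : a ^+ d = expR (d%:R * ln a / 2) ^+ 2.
      rewrite -expRM_natl mulrC divfK ?pnatr_eq0 // expRM_natl lnK ?posrE //.
    by rewrite sqrtr_sqr ger0_norm // expR_ge0.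
  rewrite -expRN -expRD -[X in X <= _]lnK ?posrE ?ltr0n // ler_expR.
  have h1 : ln t.+1%:R <= d%:R * ln t.+1%:R :> R.
    by rewrite ler_peMl ?ln_ge0 // ler1n.
  have h2 : B / 2 <= (r ^+ 2 * B + 1) / (2 * sg ^+ 2).
    rewrite sqr_sqrtr ?(ltW sg2) // ler_pdivlMr ?mulr_gt0 //.
    rewrite mulrA divfK ?pnatr_eq0 // mulrDr mulrC lerD2l.
    by rewrite ler_pdivrMr // mul1r; lra.
  lra.
rewrite -(@lee_pmul2l _ t.+1%:R%:E) ?lte_fin ?ltr0n //.
rewrite -EFinM divff ?pnatr_eq0 //.
by apply: le_trans tail; rewrite lee_wpmul2r // lee_fin.
Qed.

End SelfNormalizedMartingale.

(** * Regret *)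

Section Round.
Context {R : realType} {d : nat}.

Lemma sqrtrD_le (a b : R) : 0 <= a -> 0 <= b -> Num.sqrt (a + b) <= Num.sqrt a + Num.sqrt b.
Proof.
move=> a0 b0; rewrite -[leRHS]ger0_norm ?addr_ge0 ?sqrtr_ge0 // -sqrtr_sqr ler_wsqrtr //.
rewrite sqrrD !sqr_sqrtr //.
have : 0 <= Num.sqrt a * Num.sqrt b by rewrite mulr_ge0 ?sqrtr_ge0.
by move: (Num.sqrt a * Num.sqrt b) => p p0; lra.
Qed.

Lemma round_regret (T : nat) (beta : R) (Vinv : 'M[R]_d) (thh th lead x b : 'cV[R]_d)
  (Ar : set 'cV[R]_d) :
  let g a := beta * qform Vinv a in
  (2 <= T)%N -> (forall a, 0 <= g a) ->
  (forall a, `|dotv thh a - dotv th a| <= 2 * Num.sqrt (g a)) ->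
  Ar lead -> (forall a, Ar a -> dotv thh a <= dotv thh lead) ->
  (forall a, Ar a ->
    (linimed2_index T beta Vinv thh lead x <= linimed2_index T beta Vinv thh lead a)%E) ->
  Ar b -> g x <= 1 ->
  dotv th b - dotv th x <=
  2 * expR 2 / Num.sqrt T%:R + (2 * expR 2 + 2 + Num.sqrt (ln T%:R)) * Num.sqrt (g x).
Proof.
move=> g T2 g0 conf Alead lead_max xmin Ab gx1.
have T0 : (0 : R) < T%:R by rewrite ltr0n (leq_trans _ T2).
have lnT0 : 0 <= ln (T%:R : R) by rewrite ln_ge0 // ler1n (leq_trans _ T2).
have gpos a : g a != 0 -> 0 < g a by rewrite lt_neqAle eq_sym g0 andbT.
have lead_le : (linimed2_index T beta Vinv thh lead lead <= (ln T%:R)%:E)%E.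
  rewrite /linimed2_index eqxx; case: ifP => _ //.
  by rewrite lee_fin ge_min lexx.
(* The pulled index is at most [ln T], the cap on the leader. This excludes [+oo] and bounds the gap
   of [x]; in each case [expR (- I)] is at most one of the two terms of the sum. *)
have [I [IE expI Dx]] : exists I : R,
    [/\ linimed2_index T beta Vinv thh lead x = I%:E, expR (- I) <= T%:R^-1 + g x &
        dotv thh lead - dotv thh x <= Num.sqrt (ln T%:R) * Num.sqrt (g x)].
  have := le_trans (xmin _ Alead) lead_le.
  rewrite /linimed2_index -/(g x); have [->|xl] := eqVneq x lead.
    move=> _; have D0 : dotv thh lead - dotv thh lead <= Num.sqrt (ln T%:R) * Num.sqrt (g lead).
      by rewrite subrr mulr_ge0 ?sqrtr_ge0.
    have [gl|gl] := eqVneq (g lead) 0.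
      by exists (ln T%:R); split; rewrite // gl addr0 expRN lnK.
    exists (Num.min (ln T%:R) (- ln (g lead))); split=> //.
    have [_|_] := leP (ln T%:R) (- ln (g lead)).
      by rewrite expRN lnK ?posrE // lerDl.
    by rewrite opprK lnK ?posrE ?gpos // lerDr invr_ge0 ltW.
  have [gx|/gpos gx] := eqVneq (g x) 0; first by rewrite leye_eq.
  set D := dotv thh lead - _; rewrite lee_fin => h.
  have D2 : 0 <= D ^+ 2 / g x by rewrite divr_ge0 ?sqr_ge0.
  exists (D ^+ 2 / g x - ln (g x)); split=> //.
    apply: (@le_trans _ _ (g x)); last by rewrite lerDr invr_ge0 ltW.
    by rewrite -[leRHS]lnK ?posrE // ler_expR; lra.
  have lg : ln (g x) <= 0 by rewrite ln_le0.
  rewrite (le_trans (ler_norm _)) // -sqrtr_sqr -sqrtrM // ler_wsqrtr //.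
  by rewrite -ler_pdivrMr //; lra.
(* The excess of the optimistic value of [b] over the best estimate; only a positive excess needs an
   argument. *)
have explore : 2 * Num.sqrt (g b) - (dotv thh lead - dotv thh b) <=
    2 * expR 2 * Num.sqrt (T%:R^-1 + g x).
  have rhs0 : 0 <= 2 * expR 2 * Num.sqrt (T%:R^-1 + g x).
    by rewrite mulr_ge0 ?sqrtr_ge0 // mulr_ge0 ?expR_ge0.
  have Db : 0 <= dotv thh lead - dotv thh b by rewrite subr_ge0 lead_max.
  have [h|h] := leP (2 * Num.sqrt (g b)) (dotv thh lead - dotv thh b); first by lra.
  have gb : 0 < g b.
    rewrite gpos //; apply: contraTneq h => ->.
    by rewrite sqrtr0 mulr0 -leNgt.
  (* The estimated gap is below [2 * Num.sqrt (g b)], so its square over [g b] is at most 4; if [b]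
     is the leader, [- ln (g b)] alone is a bound. *)
  have Ib : I <= 4 - ln (g b).
    rewrite -lee_fin -IE; apply: le_trans (xmin b Ab) _.
    rewrite /linimed2_index -/(g b) (gt_eqF gb); case: ifP => _; rewrite lee_fin.
      rewrite (@le_trans _ _ (- ln (g b))) ?ge_min ?lexx ?orbT //; lra.
    rewrite lerD2r ler_pdivrMr // -[X in 4 * X](sqr_sqrtr (ltW gb)).
    have -> : 4 * Num.sqrt (g b) ^+ 2 = (2 * Num.sqrt (g b)) ^+ 2 by ring.
    by rewrite ler_sqr ?nnegrE ?(ltW h) // (le_trans Db) // ltW.
  have gble : g b <= expR 2 ^+ 2 * (T%:R^-1 + g x).
    have e : expR 2 ^+ 2 = expR 4 :> R by rewrite -expRM_natl; congr expR; ring.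
    rewrite -[leLHS]lnK ?posrE // e; apply: le_trans (ler_wpM2l (expR_ge0 4) expI).
    by rewrite -expRD ler_expR; lra.
  have : Num.sqrt (g b) <= expR 2 * Num.sqrt (T%:R^-1 + g x).
    rewrite (le_trans (ler_wsqrtr gble)) // sqrtrM ?sqr_ge0 //.
    by rewrite sqrtr_sqr ger0_norm ?expR_ge0.
  by rewrite -mulrA; move: (expR 2 * _) => z hz; lra.
have split_sqrt : Num.sqrt (T%:R^-1 + g x) <= (Num.sqrt T%:R)^-1 + Num.sqrt (g x).
  by rewrite -sqrtrV ?(ltW T0) // sqrtrD_le ?invr_ge0 ?(ltW T0).
(* The true gap is at most the excess of [b], plus the estimated gap of [x], plus the width
   [2 * Num.sqrt (g x)]. *)
have := conf b; have := conf x; rewrite !ler_norml => /andP[_ cx] /andP[cb _].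
have e2 : 0 <= 2 * expR 2 :> R by rewrite mulr_ge0 ?expR_ge0.
have := ler_wpM2l e2 split_sqrt; rewrite mulrDr => split2.
rewrite 2!mulrDl; lra.
Qed.

(** The squared deviations from the mean have a nonnegative sum. *)
Lemma sqr_sum_le (n : nat) (x : nat -> R) :
  (\sum_(0 <= s < n) x s) ^+ 2 <= n%:R * \sum_(0 <= s < n) x s ^+ 2.
Proof.
case: n => [|n]; first by rewrite !big_geq // expr0n mulr0.
set S := \sum_(0 <= s < n.+1) x s; set A := \sum_(0 <= s < n.+1) _.
have n0 : (0 : R) < n.+1%:R by rewrite ltr0n.
have : 0 <= \sum_(0 <= s < n.+1) (x s - S / n.+1%:R) ^+ 2.
  by rewrite sumr_ge0 // => s _; rewrite sqr_ge0.
have -> : \sum_(0 <= s < n.+1) (x s - S / n.+1%:R) ^+ 2 = A - S ^+ 2 / n.+1%:R.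
  under eq_bigr do rewrite sqrrB.
  rewrite big_split /= big_split /= sumrN -/A sumrMnl -mulr_suml -/S sumr_const_nat subn0.
  rewrite -[_ *+ n.+1]mulr_natl; field; rewrite gt_eqF //.
by rewrite subr_ge0 ler_pdivrMr // mulrC.
Qed.

(** Bounds the summed failure probabilities, for which order [sqrt T] is enough; each term is
    compared with an increment of [2 * sqrt n]. *)
Lemma sum_inv_le_sqrt (n : nat) : \sum_(0 <= s < n) (s.+1%:R : R)^-1 <= 2 * Num.sqrt n%:R.
Proof.
elim: n => [|n IH]; first by rewrite big_geq // sqrtr0 mulr0.
rewrite big_nat_recr //= (le_trans (lerD IH (lexx _))) //.
have n1 : (1 : R) <= n.+1%:R by rewrite ler1n.
set y := Num.sqrt n.+1%:R; set x := Num.sqrt n%:R.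
have y1 : 1 <= y by rewrite -sqrtr1 ler_wsqrtr.
have x0 : 0 <= x by exact: sqrtr_ge0.
have xx : x ^+ 2 = n%:R by rewrite sqr_sqrtr.
have yy : y ^+ 2 = n.+1%:R by rewrite sqr_sqrtr.
have e : y ^+ 2 = x ^+ 2 + 1 by rewrite xx yy -natr1.
rewrite -yy -[_^-1]mul1r -lerBrDl ler_pdivrMr; last by rewrite exprn_gt0 //; lra.
rewrite [X in X <= _](_ : 1 = (y - x) * (y + x)); last by rewrite -subr_sqr e; ring.
have xy : x <= y by rewrite ler_wsqrtr // ler_nat.
have -> : (2 * y - 2 * x) * y ^+ 2 = (y - x) * (2 * y ^+ 2) by ring.
rewrite ler_wpM2l //; first by lra.
by nra.
Qed.

End Round.

(** * Regret of a run on the confidence event *)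

Section Regret.
Context {R : realType} {d : nat}.
Variables (r L lam S : R) (T : nat) (th : 'cV[R]_d) (Arms : nat -> set 'cV[R]_d).
Hypotheses (r0 : 0 <= r) (lam0 : 0 < lam) (lamS : 1 <= Num.sqrt lam * S).
Hypotheses (T2 : (2 <= T)%N) (thS : enorm th <= S).
Hypothesis Arms_le : forall t a, Arms t a -> enorm a <= L.
Hypothesis gap_le1 : forall t b, Arms t b -> sup [set dotv th a | a in Arms t] - dotv th b <= 1.

Lemma sqrt_beta_round t :
  Num.sqrt (beta_round d r L lam S t.+1) =
  r * Num.sqrt (log_radius (d := d) lam L t) + Num.sqrt lam * S.
Proof.
rewrite /beta_round subn1 /= sqrtr_sqr ger0_norm.
  by rewrite /log_radius div1r invrK.
by rewrite addr_ge0 ?(le_trans ler01 lamS) // mulr_ge0 ?sqrtr_ge0.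
Qed.

Lemma beta_round_ge1 t : 1 <= beta_round d r L lam S t.+1.
Proof.
rewrite /beta_round; set p := Num.sqrt (d%:R * _); have p0 : 0 <= p := sqrtr_ge0 _.
rewrite -[leLHS](expr1n _ 2) ler_sqr ?nnegrE //.
  by rewrite (le_trans lamS) // lerDr mulr_ge0.
by rewrite addr_ge0 ?(le_trans ler01 lamS) // mulr_ge0.
Qed.

(** Bounds the arm values from above, so that the [sup] in the regret is a true supremum. *)
Lemma arm_dotv_le t a : Arms t a -> dotv th a <= S * L.
Proof.
move=> Aa; apply: le_trans (ler_norm _) _.
have := bform_CS_sqrt (posmx1 R d) th a; rewrite !qformE -!dotvE -/(enorm th) -/(enorm a).
move/le_trans; apply; apply: ler_pM => //; rewrite ?enorm_ge0 //; exact: Arms_le Aa.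
Qed.

Lemma inst_regret_ge0 (X : nat -> 'cV[R]_d) t : Arms t (X t) -> 0 <= inst_regret Arms th X t.
Proof.
move=> AX; rewrite subr_ge0; apply: ub_le_sup; last by exists (X t).
by exists (S * L) => _ [a Aa <-]; exact: arm_dotv_le Aa.
Qed.

(** Index [t] refers to round [t.+1]. The cap at 1 makes the elliptical potential applicable. *)
Definition round_bound (X : nat -> 'cV[R]_d) (t : nat) : R :=
  2 * expR 2 / Num.sqrt T%:R + (2 * expR 2 + 2 + Num.sqrt (ln T%:R)) *
  Num.sqrt (Num.min 1 (beta_round d r L lam S t.+1 * weight lam X t)).

Lemma round_bound_ge0 X t : 0 <= round_bound X t.
Proof.
have e2 : 0 <= 2 * expR 2 :> R by rewrite mulr_ge0 ?expR_ge0.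
by rewrite addr_ge0 ?mulr_ge0 ?invr_ge0 ?sqrtr_ge0 ?addr_ge0 ?sqrtr_ge0.
Qed.

Lemma inst_regret_le (X : nat -> 'cV[R]_d) (eta : nat -> R) (t : nat) :
  qform (invmx (Vmat lam X t)) (noise_sum X eta t) <= r ^+ 2 * log_radius (d := d) lam L t + 1 ->
  linimed2_round r L lam S T Arms th X eta t.+1 ->
  inst_regret Arms th X t.+1 <= round_bound X t.
Proof.
move=> good [lead [Alead [lead_max [AX Xmin]]]]; rewrite /= in lead_max Xmin.
have e2 : 0 <= 2 * expR 2 :> R by rewrite mulr_ge0 ?expR_ge0.
have p1 : 0 <= 2 * expR 2 / Num.sqrt T%:R :> R by rewrite divr_ge0 ?sqrtr_ge0.
rewrite /round_bound /weight.
set V := invmx _ in good lead_max Xmin *; set beta := beta_round _ _ _ _ _ _ in lead_max Xmin *.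
have pV : posmx V by exact/posmx_inv/posmx_Vmat.
have beta1 : 1 <= beta by exact: beta_round_ge1.
have beta0 : 0 <= beta by rewrite (le_trans ler01).
(* Once the cap is active, the bound exceeds 1, the largest possible gap. *)
have [gx|gx] := leP 1 (beta * qform V (X t.+1)).
  rewrite sqrtr1 mulr1 (le_trans (gap_le1 AX)) //.
  have := sqrtr_ge0 (ln T%:R : R); lra.
have g0 a : 0 <= beta * qform V a by rewrite mulr_ge0 // qform_ge0.
(* The factor 2 absorbs the extra 1 of the confidence threshold, since [Num.sqrt lam * S] is at
   least 1. *)
have conf a : `|dotv (thetahat lam th X eta t) a - dotv th a| <= 2 * Num.sqrt (beta * qform V a).
  apply: le_trans (estimation_error th X eta t a lam0) _; rewrite -/V.
  rewrite sqrtrM // mulrA ler_wpM2r ?sqrtr_ge0 // sqrt_beta_round.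
  set rho := log_radius lam L t in good *.
  have S1 : Num.sqrt lam * enorm th <= Num.sqrt lam * S by rewrite ler_wpM2l ?sqrtr_ge0.
  have q1 : Num.sqrt (qform V (noise_sum X eta t)) <= r * Num.sqrt rho + 1.
    have [rho0|rho0] := leP 0 rho.
      apply: le_trans (ler_wsqrtr good) _.
      rewrite (le_trans (sqrtrD_le (mulr_ge0 (sqr_ge0 r) rho0) ler01)) //.
      by rewrite sqrtr1 sqrtrM ?sqr_ge0 // sqrtr_sqr ger0_norm.
    have h1 : qform V (noise_sum X eta t) <= 1.
      by rewrite (le_trans good) // gerDr mulr_ge0_le0 ?sqr_ge0 // ltW.
    rewrite (le_trans (ler_wsqrtr h1)) // sqrtr1 lerDr mulr_ge0 ?sqrtr_ge0 //.
  have := mulr_ge0 r0 (sqrtr_ge0 rho); move: q1 S1 lamS.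
  move: (Num.sqrt (qform _ _)) (r * _) (Num.sqrt lam * S) (Num.sqrt lam * _) => p1' p2 p3 p4.
  by move=> *; lra.
rewrite lerBlDr; apply: ge_sup; first by exists (dotv th lead); exists lead.
move=> _ [b Ab <-]; rewrite -lerBlDr.
by apply: (round_regret T2 g0 conf Alead lead_max Xmin Ab); exact: ltW.
Qed.

End Regret.

(** * Constants and summation over the rounds *)

Section Constants.
Context {R : realType}.
Variables (r L lam S : R).
Hypotheses (r0 : 0 <= r) (lam0 : 0 < lam) (lamS : 1 <= Num.sqrt lam * S).

(** Dividing by [ln 2] turns a constant into a multiple of [ln T], valid from [T = 2] on;
    [beta_const] uses the square root of the same device. *)
Definition log_const : R := 3 + ln (1 + L ^+ 2 / lam) / ln 2.

Definition beta_const : R := r * Num.sqrt log_const + Num.sqrt lam * S / Num.sqrt (ln 2).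

(** The first term collects the failure events and the [1 / sqrt T] part of each round, the second
    the sum of square roots. *)
Definition regret_const : R :=
  (2 + 2 * expR 2) / Num.sqrt (ln 2) ^+ 3 +
  ((2 * expR 2 + 2) / Num.sqrt (ln 2) + 1) * (Num.sqrt (2 * log_const) * beta_const).

Lemma ln2_gt0 : 0 < ln 2 :> R.
Proof. by rewrite ln_gt0 // ltr1n. Qed.

Lemma log_const_gt0 : 0 < log_const.
Proof.
have := ln2_gt0 => l2; apply: ltr_wpDr => //; rewrite divr_ge0 ?(ltW l2) // ln_ge0 //.
by rewrite lerDl divr_ge0 ?sqr_ge0 // ltW.
Qed.

Lemma beta_const_gt0 : 0 < beta_const.
Proof.
rewrite ltr_wpDl ?mulr_ge0 ?sqrtr_ge0 // divr_gt0 ?sqrtr_gt0 ?ln2_gt0 //.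
exact: lt_le_trans lamS.
Qed.

Lemma regret_const_gt0 : 0 < regret_const.
Proof.
have s2 : 0 < Num.sqrt (ln 2) :> R by rewrite sqrtr_gt0 ln2_gt0.
have c0 : 0 < 2 * expR 2 :> R by rewrite mulr_gt0 ?expR_gt0.
have B0 : 0 <= ((2 * expR 2 + 2) / Num.sqrt (ln 2) + 1) * (Num.sqrt (2 * log_const) * beta_const).
  by rewrite mulr_ge0 // mulr_ge0 ?sqrtr_ge0 ?(ltW beta_const_gt0).
by rewrite /regret_const ltr_pwDl // divr_gt0 ?exprn_gt0 // addr_gt0.
Qed.

Variable T : nat.
Hypothesis T2 : (2 <= T)%N.

Lemma ln2_le_lnT : ln 2 <= ln T%:R :> R.
Proof. by rewrite ler_ln ?posrE ?ltr0n ?ler_nat // (leq_trans _ T2). Qed.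

Lemma ln_growth (t : nat) : (t <= T)%N ->
  1 <= 1 + t%:R * L ^+ 2 / lam /\
  2 * ln T%:R + ln (1 + t%:R * L ^+ 2 / lam) <= log_const * ln T%:R.
Proof.
move=> tT; have l2 := ln2_gt0; have lT := ln2_le_lnT.
have T1 : (1 : R) <= T%:R by rewrite ler1n (leq_trans _ T2).
have k0 : 0 <= L ^+ 2 / lam by rewrite divr_ge0 ?sqr_ge0 // ltW.
have t1 : 1 <= 1 + t%:R * L ^+ 2 / lam by rewrite lerDl -mulrA mulr_ge0.
have tle : 1 + t%:R * L ^+ 2 / lam <= T%:R * (1 + L ^+ 2 / lam).
  by rewrite mulrDr mulr1 lerD // -mulrA ler_wpM2r // ler_nat.
have : ln (1 + t%:R * L ^+ 2 / lam) <= ln T%:R + ln (1 + L ^+ 2 / lam).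
  have T0 : (0 : R) < T%:R by rewrite (lt_le_trans ltr01).
  have kp : 0 < 1 + L ^+ 2 / lam by rewrite ltr_pwDl.
  rewrite -lnM ?posrE // ler_ln ?posrE ?mulr_gt0 //.
  by rewrite (lt_le_trans ltr01).
have k1 : 0 <= ln (1 + L ^+ 2 / lam) by rewrite ln_ge0 // lerDl.
have : ln (1 + L ^+ 2 / lam) <= ln (1 + L ^+ 2 / lam) / ln 2 * ln T%:R.
  by rewrite -mulrA ler_peMr // mulrC ler_pdivlMr // mul1r.
split=> //; rewrite /log_const [leRHS]mulrDl; lra.
Qed.

Lemma beta_round_le (d t : nat) : (1 <= d)%N -> (t < T)%N ->
  beta_round d r L lam S t.+1 <= beta_const ^+ 2 * (d%:R * ln T%:R).
Proof.
move=> d1 tT; have l2 := ln2_gt0; have lT := ln2_le_lnT; have c0 := log_const_gt0.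
have dlT : ln 2 <= d%:R * ln T%:R :> R.
  by rewrite (le_trans lT) // ler_peMl ?ler1n //; lra.
have dl0 : 0 <= d%:R * ln T%:R :> R by lra.
have sl2 : 0 < Num.sqrt (ln 2) :> R by rewrite sqrtr_gt0.
rewrite -[X in _ * X](sqr_sqrtr dl0) -exprMn /beta_round subn1 /=.
have lS0 : 0 <= Num.sqrt lam * S by rewrite (le_trans ler01).
rewrite ler_sqr ?nnegrE; first last.
- by rewrite mulr_ge0 ?sqrtr_ge0 // ltW // beta_const_gt0.
- by rewrite addr_ge0 // mulr_ge0 ?sqrtr_ge0.
rewrite /beta_const [leRHS]mulrDl lerD //.
  rewrite -[leRHS]mulrA ler_wpM2l // -sqrtrM ?(ltW c0) // ler_wsqrtr // [leRHS]mulrCA ler_wpM2l //.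
  have [a1 hle] := ln_growth (ltnW tT).
  rewrite div1r invrK lnM ?posrE ?exprn_gt0 ?ltr0n // ?(lt_le_trans ltr01) //.
  have : ln t.+1%:R <= ln T%:R :> R.
    by rewrite ler_ln ?posrE ?ltr0n ?ler_nat // (leq_trans _ T2).
  by rewrite lnXn ?ltr0n //; lra.
by rewrite -[leRHS]mulrA ler_peMr // mulrC ler_pdivlMr // mul1r ler_wsqrtr.
Qed.

(** Both [beta] and the elliptical potential are of order [d ln T], so Cauchy-Schwarz yields
    [d sqrt T ln T]; the coefficient of the round adds [sqrt (ln T)]. The summand
    [2 * Num.sqrt T%:R] is reserved for the failure events. *)
Lemma sum_round_bound (d : nat) (X : nat -> 'cV[R]_d) : (1 <= d)%N ->
  (forall s, (1 <= s <= T)%N -> enorm (X s) <= L) ->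
  2 * Num.sqrt T%:R + \sum_(0 <= t < T) round_bound r L lam S T X t <=
  regret_const * d%:R * Num.sqrt T%:R * (ln T%:R) `^ (3 / 2).
Proof.
move=> d1 XL; have l2 := ln2_gt0; have lT := ln2_le_lnT; have c0 := log_const_gt0.
have b0 := beta_const_gt0.
have T0 : (0 : R) < T%:R by rewrite ltr0n (leq_trans _ T2).
have lT0 : 0 < ln T%:R :> R by lra.
pose y : R := Num.sqrt (ln T%:R); pose z : R := Num.sqrt (ln 2); pose x : R := Num.sqrt T%:R.
have y0 : 0 < y by rewrite sqrtr_gt0.
have z0 : 0 < z by rewrite sqrtr_gt0.
have x0 : 0 < x by rewrite sqrtr_gt0.
have yy : y ^+ 2 = ln T%:R by rewrite sqr_sqrtr // ltW.
have xx : x ^+ 2 = T%:R by rewrite sqr_sqrtr // ltW.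
have zy : z <= y by rewrite ler_wsqrtr.
have -> : ln T%:R `^ (3 / 2) = y ^+ 3.
  have -> : 3 / 2 = 1 + 2^-1 :> R by field.
  rewrite powRD; last by rewrite gt_eqF // implybT.
  by rewrite powRr1 ?ltW // powR12_sqrt ?ltW // -/y -yy; ring.
pose m t := Num.min 1 (beta_round d r L lam S t.+1 * weight lam X t).
have m0 t : 0 <= m t.
  rewrite le_min ler01 mulr_ge0 ?weight_ge0 //.
  by rewrite (le_trans ler01) // beta_round_ge1.
have sum_m : \sum_(0 <= t < T) m t <=
    beta_const ^+ 2 * (d%:R * y ^+ 2) * (2 * d%:R * (log_const * y ^+ 2)).
  have [a1 hle] := ln_growth (leqnn T).
  have hln : ln (1 + T%:R * L ^+ 2 / lam) <= log_const * y ^+ 2 by rewrite yy; lra.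
  have d0 : 0 <= 2 * d%:R :> R by rewrite mulr_ge0.
  have := le_trans (elliptical_potential lam0 XL) (ler_wpM2l d0 hln).
  have B0 : 0 <= beta_const ^+ 2 * (d%:R * y ^+ 2).
    exact: mulr_ge0 (sqr_ge0 _) (mulr_ge0 (ler0n _ _) (sqr_ge0 _)).
  move=> /(ler_wpM2l B0); apply: le_trans.
  rewrite mulr_sumr big_nat [leRHS]big_nat; apply: ler_sum => t /andP[_ tT].
  have := beta_round_le d1 tT; have := beta_round_ge1 (d := d) L r0 lamS t; rewrite -yy.
  set B := _ ^+ 2 * _; rewrite /m; set be := beta_round _ _ _ _ _ _ => be1 beB.
  have w0 := weight_ge0 X t lam0; set q := weight _ _ _ in w0 *.
  (* As [1 <= be <= B], the minimum of 1 and [be * q] is at most [B] times that of 1 and [q]. *)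
  have [q1|q1] := leP 1 q.
    by rewrite ge_min mulr1 (le_trans be1).
  by rewrite ge_min ler_wpM2r ?orbT.
have sum_sqrt : \sum_(0 <= t < T) Num.sqrt (m t) <=
    x * (d%:R * y ^+ 2 * (Num.sqrt (2 * log_const) * beta_const)).
  have rhs0 : 0 <= x * (d%:R * y ^+ 2 * (Num.sqrt (2 * log_const) * beta_const)).
    have := mulr_ge0 (sqrtr_ge0 (2 * log_const)) (ltW b0).
    move/(mulr_ge0 (mulr_ge0 (ler0n R d) (sqr_ge0 y))); exact: mulr_ge0 (ltW x0).
  rewrite -ler_sqr ?nnegrE ?sumr_ge0 //.
  apply: le_trans (sqr_sum_le _ _) _.
  under eq_bigr do rewrite sqr_sqrtr //.
  apply: le_trans (ler_wpM2l (ltW T0) sum_m) _.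
  have -> : 2 * d%:R * (log_const * y ^+ 2) = d%:R * (Num.sqrt (2 * log_const) ^+ 2 * y ^+ 2).
    by rewrite [Num.sqrt _ ^+ 2]sqr_sqrtr ?mulr_ge0 ?(ltW c0) //; ring.
  by rewrite -xx le_eqVlt; apply/orP; left; apply/eqP; ring.
have -> : \sum_(0 <= t < T) round_bound r L lam S T X t =
    2 * expR 2 * x + (2 * expR 2 + 2 + y) * \sum_(0 <= t < T) Num.sqrt (m t).
  rewrite /round_bound big_split /= [in RHS]mulr_sumr; congr (_ + _).
  rewrite sumr_const_nat subn0 -/x -[_ *+ T]mulr_natr -xx; field; rewrite gt_eqF //.
have e2 : 0 <= 2 * expR 2 :> R by rewrite mulr_ge0 ?expR_ge0.
set c := 2 * expR 2 in e2 *.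
have dn1 : (1 : R) <= d%:R by rewrite ler1n.
(* Lower-order terms are padded with powers of [y / z] and with [d] up to the common shape
   [d * x * y ^+ 3]. *)
have k1 : 1 <= y / z by rewrite ler_pdivlMr // mul1r.
have part1 : 2 * x + c * x <= (2 + c) / z ^+ 3 * d%:R * x * y ^+ 3.
  rewrite -mulrDl.
  have -> : (2 + c) / z ^+ 3 * d%:R * x * y ^+ 3 = (2 + c) * x * (d%:R * (y / z) ^+ 3).
    by field; rewrite gt_eqF.
  rewrite ler_peMr ?mulr_ge0 ?addr_ge0 ?(ltW x0) //.
  by rewrite mulr_ege1 // exprn_ege1.
have part2 : (c + 2 + y) * \sum_(0 <= t < T) Num.sqrt (m t) <=
    ((c + 2) / z + 1) * (Num.sqrt (2 * log_const) * beta_const) * d%:R * x * y ^+ 3.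
  have h1 : c + 2 + y <= ((c + 2) / z + 1) * y.
    by rewrite mulrDl mul1r lerD2r mulrAC -mulrA ler_peMr // addr_ge0.
  apply: le_trans (ler_pM _ _ h1 sum_sqrt) _.
  - by rewrite !addr_ge0 // ltW.
  - by rewrite sumr_ge0 // => t _; exact: sqrtr_ge0.
  by rewrite le_eqVlt; apply/orP; left; apply/eqP; ring.
rewrite addrA; apply: le_trans (lerD part1 part2) _.
by rewrite /regret_const -/c -/z !mulrDl.
Qed.

End Constants.

(** * Expected regret *)

Theorem theorem2 (R : realType) (Rsg L S lam : R) :
  0 <= Rsg -> 0 <= L -> 0 <= S -> 0 < lam -> 1 <= Num.sqrt lam * S ->
  exists C : R, 0 < C /\
  forall (d T : nat) (dO : measure_display) (O : measurableType dO)
    (P : probability O R) (th : 'cV[R]_d) (Arms : nat -> set 'cV[R]_d)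
    (X : nat -> O -> 'cV[R]_d) (eta : nat -> O -> R),
    (1 <= d)%N -> (2 <= T)%N ->
    (* Assumption 1 *)
    (forall t a, Arms t a -> enorm a <= L) ->
    enorm th <= S ->
    (forall t b, Arms t b -> sup [set dotv th a | a in Arms t] - dotv th b <= 1) ->
    (* the actions and noises are random variables *)
    (forall t i, measurable_fun setT (fun w => X t w i 0)) ->
    (forall t, measurable_fun setT (eta t)) ->
    (* conditional Rsg-sub-Gaussian noise *)
    (forall t, (1 <= t)%N ->
       cond_subgaussian P (history_sigma th X eta t) Rsg (eta t)) ->
    (* X is a run of LinIMED-2 with horizon T *)
    (forall w t, (1 <= t <= T)%N ->
       linimed2_round Rsg L lam S T Arms th (X ^~ w) (eta ^~ w) t) ->
    (exp_regret P Arms th X T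
      <= (C * d%:R * Num.sqrt T%:R * (ln T%:R) `^ (3 / 2))%:E)%E.
Proof.
move=> r0 L0 S0 lam0 lamS; exists (regret_const Rsg L lam S).
split; first exact: regret_const_gt0.
move=> d T dO O P th Arms X eta d1 T2 Arms_le thS gap_le1 mX meta sub_eta run.
set K := (X in (_ <= X%:E)%E).
have AX w t : (1 <= t <= T)%N -> Arms t (X t w).
  by move=> /(run w) [lead [_ [_ []]]].
have XL w s : (1 <= s <= T)%N -> enorm (X s w) <= L.
  by move=> /(AX w); exact: Arms_le.
pose bad t := [set w | Rsg ^+ 2 * log_radius (d := d) lam L t + 1 <
  qform (invmx (Vmat lam (X ^~ w) t)) (noise_sum (X ^~ w) (eta ^~ w) t)].
have fail t : (t < T)%N -> measurable (bad t) /\ (P (bad t) <= ((t.+1)%:R^-1)%:E)%E.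
  move=> tT; apply: (confidence_failure lam0 r0 mX meta sub_eta d1) => w s /andP[s1 st].
  by apply: XL; rewrite s1 (leq_trans st) // ltnW.
(* [fail] speaks only of [t < T], whereas integrating the sum asks for measurability at every index;
   hence the default 0. *)
pose ind t w : R := if (t < T)%N then \1_(bad t) w else 0.
have ind0 t w : 0 <= ind t w by rewrite /ind; case: ifP.
have mind t : measurable_fun setT (ind t).
  rewrite /ind; case: (boolP (t < T)%N) => tT; last exact: measurable_cst.
  by apply: measurable_indic; case: (fail t tT).
have K0 w : \sum_(0 <= t < T) round_bound Rsg L lam S T (X ^~ w) t <= K - 2 * Num.sqrt T%:R.
  rewrite lerBrDl; apply: sum_round_bound => // s; exact: XL.
(* Round [t.+1] costs at most 1 on [bad t], by the assumption on gaps, and at most [round_bound]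
   elsewhere. *)
have pointwise w : \sum_(1 <= t < T.+1) inst_regret Arms th (X ^~ w) t <=
    K - 2 * Num.sqrt T%:R + \sum_(0 <= t < T) ind t w.
  apply: le_trans (lerD (K0 w) (lexx _)).
  rewrite -big_split big_add1 /= big_nat [leRHS]big_nat; apply: ler_sum => t /andP[_ tT].
  rewrite /ind tT indicE; have [wb|/negP wb] := boolP (w \in bad t).
    apply: le_trans (gap_le1 _ _ (AX w t.+1 tT)) _.
    by rewrite lerDr round_bound_ge0.
  rewrite addr0; apply: (inst_regret_le r0 lam0 lamS T2 thS gap_le1 _ (run w t.+1 tT)).
  by rewrite leNgt; apply/negP => hb; apply: wb; rewrite inE.
have inst0 w t : (1 <= t <= T)%N -> 0 <= inst_regret Arms th (X ^~ w) t.
  by move=> tT; apply: (inst_regret_ge0 thS Arms_le); exact: AX.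
have minst t : measurable_fun setT (fun w => inst_regret Arms th (X ^~ w) t).
  apply: measurable_funB => //; apply: measurable_dotv => // i j.
  by rewrite ord1; exact: mX.
have mX2 : measurable_fun setT (fun w => \sum_(0 <= t < T) ind t w).
  exact: measurable_sum.
have Kge0 : 0 <= K - 2 * Num.sqrt T%:R.
  (* The claim does not involve the outcome, so any one, here [point], will do. *)
  apply: le_trans (K0 point); apply: sumr_ge0 => t _; exact: round_bound_ge0.
rewrite /exp_regret.
apply: (@le_trans _ _ (\int[P]_w ((K - 2 * Num.sqrt T%:R)%:E + \sum_(0 <= t < T) (ind t w)%:E))%E).
  apply: ge0_le_integral => //.
  - move=> w _; rewrite lee_fin big_nat; apply: sumr_ge0 => t; rewrite ltnS => tT.
    exact: inst0.
  - by apply/measurable_EFinP; exact: measurable_sum.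
  - under eq_fun do rewrite sumEFin -EFinD.
    by apply/measurable_EFinP; exact: measurable_funD.
  - by move=> w _; rewrite sumEFin -EFinD lee_fin.
rewrite ge0_integralD //; first last.
- under eq_fun do rewrite sumEFin.
  exact/measurable_EFinP.
- by move=> w _; rewrite sumEFin lee_fin sumr_ge0.
rewrite integral_cst // ge0_integral_sum //; first last.
- by move=> t w _; rewrite lee_fin.
- by move=> t; exact/measurable_EFinP.
have -> : K%:E = ((K - 2 * Num.sqrt T%:R)%:E + (2 * Num.sqrt T%:R)%:E)%E.
  by rewrite -EFinD subrK.
rewrite leeD //; first by rewrite -[leRHS]mule1 lee_wpmul2l ?lee_fin ?probability_le1.
(* The failure probabilities add up to at most the reserved [2 * Num.sqrt T%:R]. *)
apply: (@le_trans _ _ (\sum_(0 <= t < T) (t.+1%:R^-1)%:E)%E); last first.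
  by rewrite sumEFin lee_fin sum_inv_le_sqrt.
rewrite big_nat [leRHS]big_nat; apply: lee_sum => t /andP[_ tT].
have [mb Pb] := fail t tT; rewrite /ind tT.
by rewrite integral_indic // setIT.
Qed.
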